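(* Let $n\ge2$ and let $q$ be a positive real number. Under the simplicial representation of $\mathrm{Braid}_n$ with parameter $q$, each dual simple braid relabels and rescales. Concretely, for each noncrossing partition $\sigma\in NC_n$, $$S_\sigma = P_\sigma\, R^{\sigma}_{\mathrm{rc}(\sigma)} = R^{\sigma}_{\mathrm{lc}(\sigma)}\, P_\sigma .$$
   Context: Permutations of $[n]=\{1,\dots,n\}$ and braids are multiplied from right to left (as functions). Let $N=\binom n2$. Noncrossing partitions. Place $n$ points in convex position in the plane, labeled $1,\dots,n$ in clockwise order. A partition of $[n]$ is noncrossing if the convex hulls of its distinct blocks are pairwise disjoint; $NC_n$ is the set of these. To $\sigma\in NC_n$ associate the permutation that is the product of the cycles $(b_1,b_2,\dots,b_m)$ ($b_1\mapsto b_2\mapsto\cdots\mapsto b_m\mapsto b_1$) over blocks $\{b_1<\dots<b_m\}$; it is called a noncrossing permutation, and partition and permutation are denoted by the same symbol. Let $\delta=(1,2,\dots,n)$. The left complement $\mathrm{lc}(\sigma)$ and right complement $\mathrm{rc}(\sigma)$ are defined by $\mathrm{lc}(\sigma)\,\sigma=\delta$ and $\sigma\,\mathrm{rc}(\sigma)=\delta$; both are again noncrossing permutations. Dual simple braids. $\mathrm{Braid}_n$ is the braid group, generated by the standard generators $s_{i,i+1}$, $1\le i<n$. For $B\subset[n]$, $s_B$ is the motion in which the points of $B$ move clockwise along the boundary of their convex hull to the next vertex, other points staying fixed (for $|B|=2$ the two points pass each other on the left; for $|B|\le1$ it is trivial). Algebraically, for $i<j$, $s_{ij}=A\,s_{j-1,j}\,A^{-1}$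 with $A=s_{i,i+1}s_{i+1,i+2}\cdots s_{j-2,j-1}$ ($A=1$ if $j=i+1$), and for $B=\{b_1<\dots<b_m\}$, $s_B=s_{b_1b_2}s_{b_2b_3}\cdots s_{b_{m-1}b_m}$. For $\sigma\in NC_n$, the dual simple braid $s_\sigma$ is the (commuting) product of the $s_B$ over blocks $B$ of $\sigma$. Simplicial representation. Let $\{e_{kl}:1\le k<l\le n\}$, in lexicographic order, be the standard basis of $\mathbb{R}^N$, with $e_{kl}=e_{lk}$. For an $N\times N$ matrix $M$, $(e_{kl})M$ is the row of $M$ indexed by $e_{kl}$, written as a linear combination of basis vectors. The simplicial representation is the homomorphism $\mathrm{Braid}_n\to GL_N(\mathbb{R})$ sending $s_{ij}$, $j=i+1$, to the matrix $S_{ij}$ with rows, for $k<l$: $q^2e_{kl}$ if $k=i,l=j$; $e_{kl}$ if $i,j\notin\{k,l\}$; $e_{jl}$ if $k=i$, $j<l$; $e_{kj}$ if $l=i$; $(q^2-q)e_{ij}+q\,e_{ki}+(1-q)e_{kl}$ if $k<i$, $l=j$; $(q^2-q)e_{ij}+q\,e_{il}+(1-q)e_{kl}$ if $k=j$. $S_\sigma$ denotes the image of $s_\sigma$. $P_\sigma$ is the matrix obtained from $S_\sigma$ by setting $q=1$; it is the permutation matrix with $(e_{kl})P_\sigma=e_{\sigma^{-1}(k)\,\sigma^{-1}(l)}$. Rescaling matrices. A labeled euclidean simplex has affinely independent labeled vertices $p_1,\dots,p_n$ in an $(n-1)$-dimensional euclidean space; its edge norm vector is the column vector $\mathbf{v}=(a_{kl})_{k<l}$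 in lexicographic order, $a_{kl}=\|p_k-p_l\|^2$. For partitions $\sigma,\tau$ of $[n]$ whose non-singleton blocks together form the hyperedges of a spanning hypertree on $[n]$ (i.e. choosing a spanning tree of the complete graph on each block of $\sigma$ and $\tau$ yields altogether a spanning tree of the complete graph on $[n]$; this holds when $\tau$ is $\mathrm{lc}(\sigma)$ or $\mathrm{rc}(\sigma)$), $R^\sigma_\tau$ is the map sending a simplex with vertices $p_k$ to the simplex (unique up to translation) with vertices $p'_k$ such that $p'_l-p'_k=q(p_l-p_k)$ whenever $k,l$ lie in a common block of $\sigma$ and $p'_l-p'_k=p_l-p_k$ whenever $k,l$ lie in a common block of $\tau$. The same symbol $R^\sigma_\tau$ denotes the $N\times N$ matrix, independent of the simplex, whose left multiplication carries the edge norm vector of each simplex to that of its image. $S_\sigma$ is said to relabel and rescale if $S_\sigma=P_\sigma R^\sigma_{\mathrm{rc}(\sigma)}=R^\sigma_{\mathrm{lc}(\sigma)}P_\sigma$. *)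

(* Defs.v *)
From HB Require Import structures.
From mathcomp Require Import all_boot all_order all_algebra all_fingroup.
From mathcomp Require Import boolp classical_sets reals.
From mathcomp Require Import ring lra zify.

Set Implicit Arguments.
Unset Strict Implicit.
Unset Printing Implicit Defensive.

Import Order.TTheory GRing.Theory Num.Theory.
Local Open Scope ring_scope.

(* The labels 1, ..., n are shifted to 0, ..., n - 1, i.e.
   they are the elements of 'I_n with their usual order. *)

Section Noncrossing.
Variables (R : realType) (n : nat).
Implicit Types (pt : 'I_n -> 'rV[R]_2) (sigma : {set {set 'I_n}}).

Definition conv_hull pt (B : {set 'I_n}) : set 'rV[R]_2 :=
  [set x | exists w : 'I_n -> R,
     [/\ forall i, 0 <= w i,
         forall i, i \notin B -> w i = 0,
         \sum_i w i = 1
       & x = \sum_i w i *: pt i]]%classic.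

Definition convex_position pt : Prop :=
  forall i, ~ conv_hull pt [set~ i] (pt i).

(* The signed area of the triangle (pt i, pt j, pt k) is negative, the axes
   being oriented as usual. *)
Definition clockwise pt : Prop :=
  forall i j k : 'I_n, (i < j)%N -> (j < k)%N ->
    (pt j 0 0 - pt i 0 0) * (pt k 0 1 - pt i 0 1)
    - (pt j 0 1 - pt i 0 1) * (pt k 0 0 - pt i 0 0) < 0.

Definition noncrossing pt sigma : Prop :=
  finset.partition sigma [set: 'I_n] /\
  forall B C : {set 'I_n}, B \in sigma -> C \in sigma -> B != C ->
    (conv_hull pt B `&` conv_hull pt C)%classic = classical_sets.set0.

Lemma placement_exists :
  exists pt : 'I_n -> 'rV[R]_2, convex_position pt /\ clockwise pt.
Proof.
exists (fun k => \row_c (if c == 0 then k%:R else - (k%:R ^+ 2))).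
split=> [i [w [w0 wi w1 /rowP e]]|i j k ij jk]; last first.
  rewrite !mxE /=.
  have : (i%:R : R) < j%:R by rewrite ltr_nat.
  have : (j%:R : R) < k%:R by rewrite ltr_nat.
  move: (i%:R : R) (j%:R : R) (k%:R : R) => x y z yz xy.
  have : 0 < (y - x) * ((z - x) * (z - y)) by rewrite !mulr_gt0 ?subr_gt0 // (lt_trans xy).
  have -> : (y - x) * (- z ^+ 2 - - x ^+ 2) - (- y ^+ 2 - - x ^+ 2) * (z - x)
    = - ((y - x) * ((z - x) * (z - y))) by ring.
  by rewrite oppr_lt0.
have e0 := e 0; have e1 := e 1.
rewrite !summxE !mxE /= in e0 e1.
have H : \sum_j w j * (j%:R - i%:R) ^+ 2 = 0 :> R.
  transitivity (- (\sum_j (w j *: (\row_c (if c == 0 then j%:R else - j%:R ^+ 2) : 'rV[R]_2)) 0 1)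
      - 2 * i%:R * (\sum_j (w j *: (\row_c (if c == 0 then j%:R else - j%:R ^+ 2) : 'rV[R]_2)) 0 0)
      + i%:R ^+ 2 * \sum_j w j).
    rewrite !mulr_sumr -sumrN -sumrB -big_split /=; apply: eq_bigr => j _.
    by rewrite !mxE /=; ring.
  by rewrite -e0 -e1 w1; ring.
have /psumr_eq0P Z : forall j, true -> 0 <= w j * (j%:R - i%:R) ^+ 2.
  by move=> j _; rewrite mulr_ge0 ?sqr_ge0.
have w_eq0 j : w j = 0.
  have [->|ji] := eqVneq j i; first by apply: wi; rewrite !inE eqxx.
  have /eqP := Z H j isT; rewrite mulf_eq0 sqrf_eq0 subr_eq0 eqr_nat val_eqE.
  by rewrite (negPf ji) orbF => /eqP.
by move: w1; rewrite big1 // => /eqP; rewrite eq_sym oner_eq0.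
Qed.

End Noncrossing.

Section NoncrossingPerm.
Variable n : nat.
Implicit Types (B : {set 'I_n}) (sigma : {set {set 'I_n}}) (f : {perm 'I_n}).

(* [enum B] lists B in increasing order, so this is the cycle
   b_1 |-> b_2 |-> ... |-> b_m |-> b_1; [next] fixes the points outside B. *)
Definition block_cycle B : {perm 'I_n} :=
  perm (can_inj (prev_next (enum_uniq (mem B)))).

Definition nc_perm sigma : {perm 'I_n} :=
  (\prod_(B in sigma) block_cycle B)%g.

Definition delta : {perm 'I_n} := block_cycle [set: 'I_n].

(* The product of {perm _} is composition from left to right, so these two
   definitions say lc o sigma = delta and sigma o rc = delta as functions; see
   [lcE] and [rcE]. *)
Definition lc f : {perm 'I_n} := (f^-1 * delta)%g.
Definition rc f : {perm 'I_n} := (delta * f^-1)%g.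

Lemma lcE f x : lc f (f x) = delta x.
Proof. by rewrite permM permK. Qed.

Lemma rcE f x : f (rc f x) = delta x.
Proof. by rewrite permM permKV. Qed.

End NoncrossingPerm.

Section BraidGroup.
Variable n : nat.

(* The letter (i, false) is the standard generator exchanging i and i + 1 and
   (i, true) is its inverse. *)
Definition braid_word := seq ('I_n.-1 * bool).

Inductive braid_eq : braid_word -> braid_word -> Prop :=
| braid_eq_refl u : braid_eq u u
| braid_eq_sym u v : braid_eq u v -> braid_eq v u
| braid_eq_trans v u w : braid_eq u v -> braid_eq v w -> braid_eq u w
| braid_eq_cat u u' v v' :
    braid_eq u u' -> braid_eq v v' -> braid_eq (u ++ v) (u' ++ v')
| braid_eq_cancel i b : braid_eq [:: (i, b); (i, ~~ b)] [::]
| braid_eq_far (i j : 'I_n.-1) : (i.+1 < j)%N ->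
    braid_eq [:: (i, false); (j, false)] [:: (j, false); (i, false)]
| braid_eq_near (i j : 'I_n.-1) : j = i.+1 :> nat ->
    braid_eq [:: (i, false); (j, false); (i, false)]
             [:: (j, false); (i, false); (j, false)].

Definition braid_eqb : rel braid_word := fun u v => `[< braid_eq u v >].

Lemma braid_eqb_refl : reflexive braid_eqb.
Proof. by move=> u; apply/asboolP; apply: braid_eq_refl. Qed.

Lemma braid_eqb_sym : symmetric braid_eqb.
Proof. by move=> u v; apply/asboolP/asboolP; apply: braid_eq_sym. Qed.

Lemma braid_eqb_trans : transitive braid_eqb.
Proof.
by move=> v u w /asboolP uv /asboolP vw; apply/asboolP; apply: braid_eq_trans vw.
Qed.

Canonical braid_equiv :=
  EquivRel braid_eqb braid_eqb_refl braid_eqb_sym braid_eqb_trans.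

Definition Braid := {eq_quot braid_equiv}%qT.
HB.instance Definition _ := Choice.on Braid.
HB.instance Definition _ := EqQuotient.on Braid.

Definition braid_class (u : braid_word) : Braid := (\pi_Braid u)%qT.

Definition braid_repr (x : Braid) : braid_word := generic_quotient.repr x.

Lemma braid_classP u v : braid_class u = braid_class v <-> braid_eq u v.
Proof.
split=> [/eqmodP/asboolP //|uv]; apply/eqmodP; exact/asboolP.
Qed.

Lemma braid_class_repr (x : Braid) : braid_class (braid_repr x) = x.
Proof. exact: reprK. Qed.

Lemma repr_braid_class u : braid_eq (braid_repr (braid_class u)) u.
Proof. by apply/braid_classP; rewrite braid_class_repr. Qed.

Definition word_inv (u : braid_word) : braid_word :=
  rev [seq (l.1, ~~ l.2) | l <- u].

Lemma word_invK : involutive word_inv.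
Proof.
move=> u; rewrite /word_inv map_rev revK -map_comp -[RHS]map_id.
by apply: eq_map => -[i b] /=; rewrite negbK.
Qed.

Lemma braid_eq_mulV u : braid_eq (u ++ word_inv u) [::].
Proof.
elim: u => [|[i b] u IH] /=; first exact: braid_eq_refl.
rewrite /word_inv /= rev_cons -cats1 catA -/(word_inv u).
apply: (@braid_eq_trans ([:: (i, b)] ++ [::] ++ [:: (i, ~~ b)])).
  apply: (@braid_eq_cat [:: _] [:: _]); first exact: braid_eq_refl.
  by apply: braid_eq_cat => //; apply: braid_eq_refl.
exact: braid_eq_cancel.
Qed.

Definition braid_mul (x y : Braid) := braid_class (braid_repr x ++ braid_repr y).
Definition braid_one := braid_class [::].
Definition braid_inv (x : Braid) := braid_class (word_inv (braid_repr x)).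

Lemma braid_mulE u v :
  braid_mul (braid_class u) (braid_class v) = braid_class (u ++ v).
Proof. by apply/braid_classP; apply: braid_eq_cat; apply: repr_braid_class. Qed.

Lemma braid_mulA : associative braid_mul.
Proof.
move=> x y z; rewrite -(braid_class_repr x) -(braid_class_repr y).
by rewrite -(braid_class_repr z) !braid_mulE catA.
Qed.

Lemma braid_mul1 : left_id braid_one braid_mul.
Proof. by move=> x; rewrite -(braid_class_repr x) braid_mulE. Qed.

Lemma braid_mulr1 : right_id braid_one braid_mul.
Proof. by move=> x; rewrite -(braid_class_repr x) braid_mulE cats0. Qed.

Lemma braid_mulrV : right_inverse braid_one braid_inv braid_mul.
Proof.
move=> x; rewrite -[X in braid_mul X _]braid_class_repr braid_mulE.
by apply/braid_classP; apply: braid_eq_mulV.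
Qed.

Lemma braid_mulV : left_inverse braid_one braid_inv braid_mul.
Proof.
move=> x; rewrite -[X in braid_mul _ X]braid_class_repr braid_mulE.
by apply/braid_classP; rewrite -{2}(word_invK (braid_repr x)); apply: braid_eq_mulV.
Qed.

HB.instance Definition _ := isGroup.Build Braid
  braid_mulA braid_mul1 braid_mulr1 braid_mulV braid_mulrV.

End BraidGroup.

Section DualSimple.
Variable n : nat.
Implicit Types (B : {set 'I_n}) (sigma : {set {set 'I_n}}).

(* The generator s_{i,i+1}; the value for i >= n - 1 is irrelevant. *)
Definition s_std (i : nat) : Braid n :=
  if insub i is Some i' then braid_class [:: (i', false)] else 1%g.

Definition s_pair (i j : 'I_n) : Braid n :=
  let A := (\prod_(i <= k < j.-1) s_std k)%g in (A * s_std j.-1 * A^-1)%g.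

Definition s_block B : Braid n :=
  (\prod_(p <- zip (enum B) (behead (enum B))) s_pair p.1 p.2)%g.

(* For a noncrossing sigma the factors commute, so that the order in which the
   blocks are enumerated does not matter. *)
Definition s_dual sigma : Braid n := (\prod_(B in sigma) s_block B)%g.

End DualSimple.

Definition edge (n : nat) : predArgType :=
  {p : 'I_n * 'I_n | (p.1 < p.2)%N}.
HB.instance Definition _ n := Finite.on (edge n).

Notation nedges n := #|{: edge n}|.

Lemma card_edge n : nedges n = 'C(n, 2).
Proof.
rewrite card_sig -bin2_sum big_mkord -sum1_card.
rewrite (eq_bigl (fun p : 'I_n * 'I_n => xpredT p.2 && (p.1 < p.2)%N)) //.
rewrite -(pair_big_dep xpredT (fun i j : 'I_n => (i < j)%N) (fun _ _ => 1%N)) /=.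
rewrite (exchange_big_dep xpredT) //=.
apply: eq_bigr => j _.
rewrite big_mkcond /= (eq_bigr (fun i : 'I_n => (i < j)%N : nat)); last by move=> i; case: ltnP.
rewrite -(big_mkord xpredT (fun i => (i < j)%N : nat)).
rewrite (big_cat_nat (n := j)) ?(ltnW (ltn_ord j)) //=.
rewrite [X in (_ + X)%N]big_nat_cond [X in (_ + X)%N]big1 ?addn0; last first.
  by move=> i /andP[/andP[ji _] _]; rewrite ltnNge ji.
rewrite (eq_big_nat _ _ (F2 := fun => 1%N)); last by move=> i /andP[_ ->].
by rewrite sum_nat_const_nat subn0 muln1.
Qed.

(* The numbering [enum_rank] of the edges is the lexicographic one. *)
Lemma edge_lexi n (e f : edge n) :
  (enum_rank e < enum_rank f)%N =
  ((val e).1 < (val f).1)%N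
  || ((val e).1 == (val f).1) && ((val e).2 < (val f).2)%N.
Proof.
pose lt2 (p q : 'I_n * 'I_n) :=
  (p.1 < q.1)%N || (p.1 == q.1) && (p.2 < q.2)%N.
have lt2_trans : transitive lt2.
  move=> [b b'] [a a'] [c c']; rewrite /lt2 /= -!val_eqE /=; lia.
have lt2_pairs : pairwise lt2 (enum {: 'I_n * 'I_n}).
  have ord_pw : pairwise (fun i j : 'I_n => (i < j)%N) (enum 'I_n).
    rewrite -(pairwise_map val ltn) val_enum_ord -sorted_pairwise ?iota_ltn_sorted //.
    exact: ltn_trans.
  rewrite enumT unlock /= /prod_enum.
  suff: forall s : seq 'I_n, pairwise (fun i j : 'I_n => (i < j)%N) s ->
      pairwise lt2 [seq (x1, x2) | x1 <- s, x2 <- enum 'I_n] by exact.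
  elim=> //= x s IH /andP[xs /IH pw].
  rewrite pairwise_cat pw andbT; apply/andP; split.
    apply/allrelP => _ [y y'] /mapP[z _ ->] /allpairsP[[u v] [/= us _ [-> _]]].
    by rewrite /lt2 /= (allP xs _ us).
  rewrite pairwise_map; apply: sub_pairwise ord_pw => i j ij.
  by rewrite /lt2 /= eqxx ij orbT.
have lt2_edges : sorted (relpre val lt2) (enum (edge n)).
  have := pairwise_filter (fun p : 'I_n * 'I_n => (p.1 < p.2)%N) lt2_pairs.
  have <- : map val (enum (edge n)) =
      filter (fun p : 'I_n * 'I_n => (p.1 < p.2)%N) (enum {: 'I_n * 'I_n}).
    rewrite [in LHS]enumT [in LHS]unlock /= Builders_26.val_sub_enum.
    by rewrite [LHS]/enum_mem [in RHS]enumT.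
  by rewrite pairwise_map => /pairwise_sorted.
have rankE (g : edge n) : enum_rank g = index g (enum (edge n)) :> nat.
  rewrite -[in RHS](enum_rankK g) /enum_val index_uniq //.
  - by rewrite -cardE.
  - exact: enum_uniq.
have tr : transitive (relpre (val : edge n -> _) lt2).
  by move=> ? ? ?; apply: lt2_trans.
have lt_rank (g h : edge n) :
    (enum_rank g < enum_rank h)%N -> lt2 (val g) (val h).
  rewrite !rankE => gh.
  by apply: (sorted_ltn_index tr lt2_edges) gh; rewrite mem_enum.
apply/idP/idP => [/lt_rank //|ef].
have {ef} : lt2 (val e) (val f) by [].
case: (ltngtP (enum_rank e) (enum_rank f)) => // [/lt_rank|/val_inj/enum_rank_inj ->].
  by move=> fe ef; have := lt2_trans _ _ _ fe ef; rewrite /lt2 !ltnn andbF.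
by rewrite /lt2 !ltnn andbF.
Qed.

(* The relations between two generators, abstractly: [b] is a symmetric family
   of vectors on which [A] acts as the generator on i, j and [B] as the
   generator on k, l. *)
Section GenRelations.
Variables (R : realType) (T : finType) (N : nat) (q : R).
Variables (b : T -> T -> 'rV[R]_N) (bC : forall k l, b k l = b l k).
Hypothesis b_inj : forall M M' : 'M[R]_N,
  (forall k l, k != l -> b k l *m M = b k l *m M') -> M = M'.

Definition acts_as_gen (i j : T) (A : 'M[R]_N) : Prop :=
  [/\ b i j *m A = q ^+ 2 *: b i j,
      forall k l, k != l -> k \notin [:: i; j] -> l \notin [:: i; j] ->
        b k l *m A = b k l,
      forall m, m \notin [:: i; j] -> b i m *m A = b j m
    & forall m, m \notin [:: i; j] -> b j m *m A =
        (q ^+ 2 - q) *: b i j + q *: b i m + (1 - q) *: b j m].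

Lemma gen_near i j k A B : uniq [:: i; j; k] ->
  acts_as_gen i j A -> acts_as_gen j k B ->
  A *m (B *m A) = B *m (A *m B).
Proof.
rewrite /= !inE !negb_or andbT => /andP[/andP[ij ik] jk].
move=> [g1 g2 g3 g4] [h1 h2 h3 h4].
have nkg : k \notin [:: i; j] by rewrite !inE negb_or ![k == _]eq_sym ik jk.
have nih : i \notin [:: j; k] by rewrite !inE negb_or ij ik.
have Eg_ik := g3 k nkg. have Eg_jk := g4 k nkg.
have Eh_ij : b i j *m B = b i k by rewrite bC h3 // bC.
have Eh_ik : b i k *m B =
    (q ^+ 2 - q) *: b j k + q *: b i j + (1 - q) *: b i k.
  by rewrite bC h4 // (bC j i) (bC k i).
pose E := (mulmxDl, =^~ scalemxAl, g1, Eg_ik, Eg_jk, h1, Eh_ij, Eh_ik).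
have Hij : b i j *m (A *m (B *m A)) = b i j *m (B *m (A *m B)).
  by rewrite !mulmxA !E; apply/rowP => c; rewrite ?mxE; ring.
have Hik : b i k *m (A *m (B *m A)) = b i k *m (B *m (A *m B)).
  by rewrite !mulmxA !E; apply/rowP => c; rewrite ?mxE; ring.
have Hjk : b j k *m (A *m (B *m A)) = b j k *m (B *m (A *m B)).
  by rewrite !mulmxA !E; apply/rowP => c; rewrite ?mxE; ring.
have Hout y m : y \in [:: i; j; k] -> m \notin [:: i; j; k] ->
    b y m *m (A *m (B *m A)) = b y m *m (B *m (A *m B)).
  move=> yin mout.
  have [mo1 mo2] : m \notin [:: i; j] /\ m \notin [:: j; k].
    by move: mout; rewrite !inE !negb_or => /and3P[-> -> ->].
  have im : i != m by apply: contraNneq mout => <-; rewrite inE eqxx.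
  have km : k != m by apply: contraNneq mout => <-; rewrite !inE eqxx !orbT.
  have F1 := g3 m mo1; have F2 := g4 m mo1; have F3 := h3 m mo2.
  have F4 := h4 m mo2; have F5 := g2 k m km nkg mo1.
  have F6 := h2 i m im nih mo2.
  move: yin; rewrite !inE => /or3P[] /eqP -> {y}; rewrite !mulmxA;
    rewrite !(E, (F1, F2, F3, F4, F5, F6));
    apply/rowP => c; rewrite ?mxE; ring.
apply: b_inj => x y xy.
have [xin|xout] := boolP (x \in [:: i; j; k]); last first.
  have [yin|yout] := boolP (y \in [:: i; j; k]); first by rewrite bC Hout.
  have [xo1 xo2] : x \notin [:: i; j] /\ x \notin [:: j; k].
    by move: xout; rewrite !inE !negb_or => /and3P[-> -> ->].
  have [yo1 yo2] : y \notin [:: i; j] /\ y \notin [:: j; k].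
    by move: yout; rewrite !inE !negb_or => /and3P[-> -> ->].
  by rewrite !mulmxA !(g2 x y, h2 x y).
have [yin|yout] := boolP (y \in [:: i; j; k]); last exact: Hout.
move: xin yin xy; rewrite !inE.
move=> /or3P[] /eqP -> /or3P[] /eqP ->; rewrite ?eqxx // => _; by rewrite bC.
Qed.

Lemma gen_far i j k l A B : uniq [:: i; j; k; l] ->
  acts_as_gen i j A -> acts_as_gen k l B -> A *m B = B *m A.
Proof.
rewrite /= !inE !negb_or andbT => /and3P[/and3P[ij ik il] /andP[jk jl] kl].
move=> [g1 g2 g3 g4] [h1 h2 h3 h4].
have io : i \notin [:: k; l] by rewrite !inE negb_or ik il.
have jo : j \notin [:: k; l] by rewrite !inE negb_or jk jl.
have ko : k \notin [:: i; j] by rewrite !inE negb_or ![k == _]eq_sym ik jk.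
have lo : l \notin [:: i; j] by rewrite !inE negb_or ![l == _]eq_sym il jl.
have Hij := h2 i j ij io jo; have Gkl := g2 k l kl ko lo.
have Gik := g3 k ko; have Gil := g3 l lo.
have Gjk := g4 k ko; have Gjl := g4 l lo.
have Hik : b i k *m B = b i l by rewrite bC h3 // bC.
have Hjk : b j k *m B = b j l by rewrite bC h3 // bC.
have Hil : b i l *m B = (q ^+ 2 - q) *: b k l + q *: b i k + (1 - q) *: b i l.
  by rewrite bC h4 // (bC k i) (bC l i).
have Hjl : b j l *m B = (q ^+ 2 - q) *: b k l + q *: b j k + (1 - q) *: b j l.
  by rewrite bC h4 // (bC k j) (bC l j).
pose E := (mulmxDl, =^~ scalemxAl, (g1, h1, Hij, Gkl), (Gik, Gil, Gjk, Gjl),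
  (Hik, Hil, Hjk, Hjl)).
have Hout y m : y \in [:: i; j; k; l] -> m \notin [:: i; j; k; l] ->
    b y m *m (A *m B) = b y m *m (B *m A).
  move=> yin mout.
  have [mo1 mo2] : m \notin [:: i; j] /\ m \notin [:: k; l].
    by move: mout; rewrite !inE !negb_or => /and4P[-> -> -> ->].
  have neq z : z \in [:: i; j; k; l] -> z != m.
    by move=> zin; apply: contraNneq mout => <-.
  have im : i != m by apply: neq; rewrite !inE eqxx.
  have jm : j != m by apply: neq; rewrite !inE eqxx !orbT.
  have km : k != m by apply: neq; rewrite !inE eqxx !orbT.
  have lm : l != m by apply: neq; rewrite !inE eqxx !orbT.
  have F1 := g3 m mo1; have F2 := g4 m mo1; have F3 := h3 m mo2.
  have F4 := h4 m mo2; have F5 := g2 k m km ko mo1.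
  have F6 := g2 l m lm lo mo1.
  have F7 := h2 i m im io mo2; have F8 := h2 j m jm jo mo2.
  move: yin; rewrite !inE => /or4P[] /eqP -> {y}; rewrite !mulmxA;
    rewrite !(E, (F1, F2, F3, F4, F5, F6, F7, F8));
    apply/rowP => c; rewrite ?mxE; ring.
apply: b_inj => x y xy.
have [xin|xout] := boolP (x \in [:: i; j; k; l]); last first.
  have [yin|yout] := boolP (y \in [:: i; j; k; l]); first by rewrite bC Hout.
  have [xo1 xo2] : x \notin [:: i; j] /\ x \notin [:: k; l].
    by move: xout; rewrite !inE !negb_or => /and4P[-> -> -> ->].
  have [yo1 yo2] : y \notin [:: i; j] /\ y \notin [:: k; l].
    by move: yout; rewrite !inE !negb_or => /and4P[-> -> -> ->].
  by rewrite !mulmxA !(g2 x y, h2 x y).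
have [yin|yout] := boolP (y \in [:: i; j; k; l]); last exact: Hout.
have Hin u v : (u, v) \in [:: (i, j); (i, k); (i, l); (j, k); (j, l); (k, l)] ->
    b u v *m (A *m B) = b u v *m (B *m A).
  rewrite !inE => /or4P[|||/or3P[]] /eqP [-> ->]; rewrite !mulmxA !E;
    apply/rowP => c; rewrite ?mxE; ring.
move: xin yin xy; rewrite !inE.
move=> /or4P[] /eqP -> /or4P[] /eqP ->; rewrite ?eqxx // => _;
  try (by apply: Hin; rewrite !inE eqxx ?orbT);
  by rewrite bC; apply: Hin; rewrite !inE eqxx ?orbT.
Qed.

End GenRelations.

Section SimplicialRep.
Variables (R : realType) (n : nat).

(* The row vector e_kl = e_lk, indexed by ordered pairs; it is 0 if k = l. *)
Definition bas (k l : 'I_n) : 'rV[R]_(nedges n) :=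
  \row_a ((val (enum_val a) == (k, l)) || (val (enum_val a) == (l, k)))%:R.

Definition S_row (q : R) (i j k l : 'I_n) : 'rV[R]_(nedges n) :=
  if (k == i) && (l == j) then q ^+ 2 *: bas k l
  else if (k \notin [:: i; j]) && (l \notin [:: i; j]) then bas k l
  else if k == i then bas j l
  else if l == i then bas k j
  else if l == j then
    (q ^+ 2 - q) *: bas i j + q *: bas k i + (1 - q) *: bas k l
  else (* k == j *)
    (q ^+ 2 - q) *: bas i j + q *: bas i l + (1 - q) *: bas k l.

Lemma gen_lt (i : 'I_n.-1) : (i.+1 < n)%N.
Proof. by case: i => i /=; case: n. Qed.

Definition gen_fst (i : 'I_n.-1) : 'I_n := Ordinal (ltnW (gen_lt i)).
Definition gen_snd (i : 'I_n.-1) : 'I_n := Ordinal (gen_lt i).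

Definition S_gen (q : R) (i : 'I_n.-1) : 'M[R]_(nedges n) :=
  \matrix_(a < nedges n)
    let e := val (enum_val a) in S_row q (gen_fst i) (gen_snd i) e.1 e.2.

Lemma basC k l : bas k l = bas l k.
Proof. by apply/rowP => a; rewrite !mxE orbC. Qed.

Lemma bas_delta (e : edge n) :
  bas (val e).1 (val e).2 = delta_mx 0 (enum_rank e).
Proof.
apply/rowP => a; rewrite !mxE -surjective_pairing val_eqE /=; congr (_%:R).
rewrite -(can_eq enum_valK a) enum_rankK; set f := enum_val a.
case: eqP => //= _; case: eqP => // fe.
by have := valP f; have := valP e; rewrite /= fe /= => /ltnW; rewrite leqNgt => /negP.
Qed.

Lemma bas_S_gen q i (k l : 'I_n) : (k < l)%N ->
  bas k l *m S_gen q i = S_row q (gen_fst i) (gen_snd i) k l.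
Proof.
move=> kl; pose e : edge n := Sub (k, l) kl.
rewrite -[k]/((val e).1) -[l]/((val e).2) bas_delta -rowE.
by rewrite rowK enum_rankK.
Qed.

Section Gen.
Variables (q : R) (g : 'I_n.-1).
Let i := gen_fst g.
Let j := gen_snd g.

Lemma bas_S_ij : bas i j *m S_gen q g = q ^+ 2 *: bas i j.
Proof. by rewrite bas_S_gen // /S_row !eqxx. Qed.

Lemma bas_S_out k l : k != l -> k \notin [:: i; j] -> l \notin [:: i; j] ->
  bas k l *m S_gen q g = bas k l.
Proof.
wlog kl: k l / (k < l)%N => [H|_ ki li].
  move=> kl ki li; have := kl; rewrite -val_eqE neq_ltn => /orP[] lt_kl.
    exact: H.
  by rewrite basC H // eq_sym.
rewrite bas_S_gen // /S_row -/i -/j ki li.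
by case: eqP ki => // ->; rewrite inE eqxx.
Qed.

Lemma bas_S_i m : m \notin [:: i; j] ->
  bas i m *m S_gen q g = bas j m.
Proof.
rewrite !inE negb_or => /andP[mi mj].
have ji : j == i = false by apply/eqP => /(congr1 val) /=; lia.
have ij : i == j = false by rewrite eq_sym.
have := mi; rewrite -val_eqE neq_ltn => /orP[] lt.
- rewrite basC bas_S_gen // /S_row -/i -/j !inE (negPf mi) (negPf mj).
  by rewrite ?ij ?ji ?eqxx /= [in RHS]basC.
- rewrite bas_S_gen // /S_row -/i -/j !inE (negPf mi) (negPf mj).
  by rewrite ?ij ?ji ?eqxx.
Qed.

Lemma bas_S_j m : m \notin [:: i; j] ->
  bas j m *m S_gen q g =
  (q ^+ 2 - q) *: bas i j + q *: bas i m + (1 - q) *: bas j m.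
Proof.
rewrite !inE negb_or => /andP[mi mj].
have ji : j == i = false by apply/eqP => /(congr1 val) /=; lia.
have ij : i == j = false by rewrite eq_sym.
have := mj; rewrite -val_eqE neq_ltn => /orP[] lt.
- rewrite basC bas_S_gen // /S_row -/i -/j !inE (negPf mi) (negPf mj).
  by rewrite ?ij ?ji ?eqxx /= (basC m i).
- by rewrite bas_S_gen // /S_row -/i -/j !inE (negPf mi) (negPf mj)
    ?ij ?ji ?eqxx.
Qed.

End Gen.

Lemma bas_inj (M M' : 'M[R]_(nedges n)) :
  (forall k l, k != l -> bas k l *m M = bas k l *m M') -> M = M'.
Proof.
move=> H; apply/row_matrixP => a; rewrite !rowE.
have [e ->] : exists e, a = enum_rank e by exists (enum_val a); rewrite enum_valK.
rewrite -bas_delta; apply: H; apply/eqP => E.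
by have := valP e; rewrite /= E ltnn.
Qed.

Lemma S_gen_unit (q : R) g : q != 0 -> S_gen q g \in unitmx.
Proof.
move=> q0; set i := gen_fst g; set j := gen_snd g.
have ij : i != j by apply/eqP => /(congr1 val) /=; lia.
have rg (v : 'rV_(nedges n)) : (v *m S_gen q g <= S_gen q g)%MS by apply: submxMl.
have Hij : (bas i j <= S_gen q g)%MS.
  have := rg (q ^- 2 *: bas i j).
  by rewrite -scalemxAl bas_S_ij scalerA mulVf ?scale1r // expf_neq0.
have Hj m : m \notin [:: i; j] -> (bas j m <= S_gen q g)%MS.
  by move=> mo; rewrite -(bas_S_i q mo) rg.
have Hi m : m \notin [:: i; j] -> (bas i m <= S_gen q g)%MS.
  move=> mo; have := rg (bas j m); rewrite bas_S_j // -/i -/j => H.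
  have -> : bas i m = q^-1 *:
     (((q ^+ 2 - q) *: bas i j + q *: bas i m + (1 - q) *: bas j m)
      - (q ^+ 2 - q) *: bas i j - (1 - q) *: bas j m).
    by apply/rowP => a; rewrite !mxE; field.
  rewrite scalemx_sub // addmx_sub ?eqmx_opp ?scalemx_sub ?Hj //.
  by rewrite addmx_sub ?eqmx_opp ?scalemx_sub.
have Hall k l : k != l -> (bas k l <= S_gen q g)%MS.
  move=> kl.
  have [kin|kout] := boolP (k \in [:: i; j]); last first.
    have [lin|lout] := boolP (l \in [:: i; j]); last first.
      by rewrite -(bas_S_out q kl kout lout).
    by rewrite basC; move: lin; rewrite !inE => /orP[] /eqP ->; [apply: Hi|apply: Hj].
  have [lin|lout] := boolP (l \in [:: i; j]); last first.
    by move: kin; rewrite !inE => /orP[] /eqP ->; [apply: Hi|apply: Hj].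
  move: kin lin kl; rewrite !inE => /orP[] /eqP -> /orP[] /eqP ->; rewrite ?eqxx // => _.
  by rewrite basC.
rewrite -row_full_unit -sub1mx; apply/row_subP => a.
have [e ->] : exists e, a = enum_rank e by exists (enum_val a); rewrite enum_valK.
rewrite rowE mulmx1 -bas_delta; apply: Hall; apply/eqP => E.
by have := valP e; rewrite /= E ltnn.
Qed.

Lemma S_gen_acts q g : acts_as_gen q bas (gen_fst g) (gen_snd g) (S_gen q g).
Proof.
split; [exact: bas_S_ij | exact: bas_S_out | exact: bas_S_i | exact: bas_S_j].
Qed.

Lemma S_gen_near q (g h : 'I_n.-1) : h = g.+1 :> nat ->
  S_gen q g *m (S_gen q h *m S_gen q g) = S_gen q h *m (S_gen q g *m S_gen q h).
Proof.
move=> gh; have hg := S_gen_acts q h.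
have e : gen_fst h = gen_snd g by apply: val_inj.
rewrite e in hg; apply: (gen_near basC bas_inj _ (S_gen_acts q g) hg).
by rewrite /= !inE -!val_eqE /= gh; lia.
Qed.

Lemma S_gen_far q (g h : 'I_n.-1) : (g.+1 < h)%N ->
  S_gen q g *m S_gen q h = S_gen q h *m S_gen q g.
Proof.
move=> gh; apply: (gen_far basC bas_inj _ (S_gen_acts q g) (S_gen_acts q h)).
by rewrite /= !inE -!val_eqE /=; lia.
Qed.

Definition word_mx (q : R) (u : braid_word n) : 'M[R]_(nedges n) :=
  foldr (fun l M => (if l.2 then invmx (S_gen q l.1) else S_gen q l.1) *m M)
        1%:M u.

Lemma word_mx_cat q u v : word_mx q (u ++ v) = word_mx q u *m word_mx q v.
Proof. by elim: u => [|l u IH] /=; rewrite ?mul1mx // IH mulmxA. Qed.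

Lemma word_mx_eq q u v : q != 0 -> braid_eq u v -> word_mx q u = word_mx q v.
Proof.
move=> q0; elim=> {u v}.
- by move=> u.
- by move=> u v _ ->.
- by move=> v u w _ -> _ ->.
- by move=> u u' v v' _ Hu _ Hv; rewrite !word_mx_cat Hu Hv.
- by move=> i []; rewrite /word_mx /= mulmx1 ?mulVmx ?mulmxV ?S_gen_unit.
- by move=> i j ij; rewrite /word_mx /= !mulmx1 S_gen_far.
- by move=> i j ij; rewrite /word_mx /= !mulmx1 S_gen_near.
Qed.

(* The matrix does not depend on the word representing the braid, and one gets
   a homomorphism to GL_N(R), as soon as q != 0: see [simplicial_repE],
   [simplicial_rep1], [simplicial_repM] and [simplicial_rep_unit]. *)
Definition simplicial_rep (q : R) (x : Braid n) : 'M[R]_(nedges n) :=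
  word_mx q (braid_repr x).

Lemma simplicial_repE q u : q != 0 ->
  simplicial_rep q (braid_class u) = word_mx q u.
Proof. by move=> q0; apply: word_mx_eq => //; apply: repr_braid_class. Qed.

Lemma simplicial_rep1 q : q != 0 -> simplicial_rep q 1%g = 1%:M.
Proof. exact: simplicial_repE. Qed.

Lemma simplicial_repM q x y : q != 0 ->
  simplicial_rep q (x * y)%g = simplicial_rep q x *m simplicial_rep q y.
Proof. by move=> q0; rewrite simplicial_repE // word_mx_cat. Qed.

Lemma simplicial_rep_s_std q (i : 'I_n.-1) : q != 0 ->
  simplicial_rep q (s_std n i) = S_gen q i.
Proof.
by move=> q0; rewrite /s_std valK simplicial_repE //= mulmx1.
Qed.

Lemma simplicial_rep_unit q x : q != 0 -> simplicial_rep q x \in unitmx.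
Proof.
move=> q0; have := simplicial_rep1 q0.
by rewrite -(mulgV x) simplicial_repM // => /mulmx1_unit[].
Qed.

Definition S_mx (q : R) (sigma : {set {set 'I_n}}) : 'M[R]_(nedges n) :=
  simplicial_rep q (s_dual sigma).

Definition P_mx (sigma : {set {set 'I_n}}) : 'M[R]_(nedges n) := S_mx 1 sigma.

End SimplicialRep.

Section Rescaling.
Variables (R : realType) (n : nat).
Implicit Types (p : 'I_n -> 'rV[R]_n.-1) (sigma tau : {set {set 'I_n}}).

Definition affinely_independent p : Prop :=
  forall c : 'I_n -> R, \sum_k c k = 0 -> \sum_k c k *: p k = 0 ->
    forall k, c k = 0.

Definition sqdist (x y : 'rV[R]_n.-1) : R := \sum_i (x 0 i - y 0 i) ^+ 2.

Definition edge_norms p : 'cV[R]_(nedges n) :=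
  \col_a let e := val (enum_val a) in sqdist (p e.1) (p e.2).

Definition rescaled (q : R) sigma tau p p' : Prop :=
  (forall B k l, B \in sigma -> k \in B -> l \in B ->
     p' l - p' k = q *: (p l - p k)) /\
  (forall B k l, B \in tau -> k \in B -> l \in B ->
     p' l - p' k = p l - p k).

Definition is_rescaling_mx (q : R) sigma tau (M : 'M[R]_(nedges n)) : Prop :=
  forall p p', affinely_independent p -> affinely_independent p' ->
    rescaled q sigma tau p p' -> M *m edge_norms p = edge_norms p'.

(* The matrix R^sigma_tau, by definite description: when sigma and tau form a
   spanning hypertree, exactly one matrix satisfies [is_rescaling_mx]. *)
Definition rescaling_mx (q : R) sigma tau : 'M[R]_(nedges n) :=
  xget 0 [set M | is_rescaling_mx q sigma tau M]%classic.

(* The partition attached to a noncrossing permutation is that of its orbits. *)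
Definition relabels_and_rescales (q : R) sigma : Prop :=
  let f := nc_perm sigma in
  S_mx q sigma = P_mx R sigma *m rescaling_mx q sigma (porbits (rc f)) /\
  S_mx q sigma = rescaling_mx q sigma (porbits (lc f)) *m P_mx R sigma.

End Rescaling.

(* Main.v *)
Require Import Defs.
From mathcomp Require Import all_boot all_order all_algebra all_fingroup.
From mathcomp Require Import boolp classical_sets reals.
From mathcomp Require Import ring lra zify.

(** The simplicial representation is the Burau representation seen through
    squared distances.  By Stewart's formula ([stewart]), the matrix of a
    standard generator carries the edge norms of a configuration
    p_1, ..., p_n to those of the configuration in which p_i is replaced by p_j
    and p_j by p_j + q (p_i - p_j) ([realizes_gen]); this is a linear map of
    configurations, so products and inverses of the matrices can be computed on
    points ([realizesM], [realizesV]).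

    In these terms s_B acts by one formula ([move]), up to relabelling: a label
    lying weakly before the last vertex of B and strictly after its first one
    is translated by (1 - q)(p_max - p_b), where b is the vertex of B just before
    it, and the other labels do not move.  For two vertices this follows by
    conjugation ([move_conj]), for longer blocks by peeling off the first
    vertex ([move_cons]).  When B and C do not cross, C sits in a single gap of
    B, so B translates all of C by one vector and does not disturb the
    differences that determine the translation due to C.  Hence for a
    noncrossing sigma the image of p is p'_k = p_(sigma^-1 k) + D_k, where D is
    the sum of the translations due to the blocks ([realizes_family]).

    Rescaling is now two properties of D.  Inside a block, D_(sigma k) equals
    (1 - q)(p_max - p_k) up to a constant, whence
    p'_(sigma l) - p'_(sigma k) = q (p_l - p_k) ([total_drift_block]).  Moreover
    D_(delta m) = D_(sigma m) for every m ([total_drift_delta]): both labels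
    lie in the same gap of every block.  This equation says that differences are
    preserved along the orbits of lc(sigma) if one composes with the inverse
    relabelling on the right, and along those of rc(sigma) if one composes on
    the left.

    The rescaling matrix is given by definite description, so it remains to see
    that these properties determine it.  Blocks and orbits together connect all
    labels, because sigma and its complement multiply to delta; so the rescaled
    configuration is unique up to translation.  The matrix is then unique
    because edge norms of nondegenerate simplices span ([edge_norms_span]).
    Finally, convex hulls of crossing blocks meet because the diagonals of a
    convex quadrilateral do ([diagonals_cross]). *)

Set Implicit Arguments.
Unset Strict Implicit.
Unset Printing Implicit Defensive.

Import Order.TTheory GRing.Theory Num.Theory.
Local Open Scope ring_scope.

(** * Cyclic predecessors in a set of labels *)

(** The last element of [s] met strictly before [k] on the circle, hence the last
    element of [s] when none of them is smaller than [k].  Two labels outside a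
    nonempty [s] lie in the same gap of [s] exactly when they have the same pivot. *)
Definition pivot (n : nat) (s : seq 'I_n) (k : 'I_n) : 'I_n :=
  last (last k s) [seq b : 'I_n <- s | (b < k)%N].

Definition increasing (n : nat) (s : seq 'I_n) : bool :=
  sorted (fun i j : 'I_n => (i < j)%N) s.

Section Pivot.
Variable n : nat.
Implicit Types (s : seq 'I_n) (i j k : 'I_n) (B C : {set 'I_n}).

Lemma ltn_ord_trans : transitive (fun i j : 'I_n => (i < j)%N).
Proof. by move=> j i k; apply: ltn_trans. Qed.

Lemma increasing_cons i s :
  increasing (i :: s) = all (fun j : 'I_n => (i < j)%N) s && increasing s.
Proof. exact: (path_sortedE ltn_ord_trans). Qed.

Lemma increasing_enum B : increasing (enum B).
Proof.
rewrite /increasing /enum_mem -enumT; apply: sorted_filter => //.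
  exact: ltn_ord_trans.
by have := iota_ltn_sorted 0 n; rewrite -val_enum_ord sorted_map.
Qed.

Lemma pivot_mem s k : s != [::] -> pivot s k \in s.
Proof.
case: s => // b s _; rewrite /pivot.
have := mem_last (last k (b :: s)) [seq c : 'I_n <- b :: s | (c < k)%N].
rewrite in_cons => /orP[/eqP ->|]; last by rewrite mem_filter => /andP[].
by rewrite /= mem_last.
Qed.

Lemma pivot_before s k : all (fun j : 'I_n => (k <= j)%N) s ->
  pivot s k = last k s.
Proof.
move=> /allP h; rewrite /pivot (eq_in_filter (a2 := pred0)) ?filter_pred0 //.
by move=> j /h; rewrite leqNgt => /negPf.
Qed.

Lemma pivot_after s k : all (fun j : 'I_n => (j < k)%N) s ->
  pivot s k = last k s.
Proof. by move=> /all_filterP h; rewrite /pivot h; case: s h. Qed.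

Lemma pivot_cons i s k : (i < k)%N ->
  pivot (i :: s) k = last i [seq b : 'I_n <- s | (b < k)%N].
Proof. by rewrite /pivot /= => ->. Qed.

Lemma increasing_uniq s : increasing s -> uniq s.
Proof.
by apply: sorted_uniq; [apply: ltn_ord_trans | move=> i; rewrite ltnn].
Qed.

Lemma pivot_prev s k : increasing s -> k \in s -> pivot s k = prev s k.
Proof.
move=> inc ks; have un := increasing_uniq inc.
case/splitPr: ks inc un => s1 s2 inc un.
have kS1 : k \notin s1.
  by move: un; rewrite cat_uniq /= negb_or; case/and3P => _ /andP[].
have kS2 : k \notin s2 by move: un; rewrite cat_uniq /=; case/and4P.
have s1P : all (fun j : 'I_n => (j < k)%N) s1.
  move: inc; rewrite /increasing (sorted_pairwise ltn_ord_trans) pairwise_cat.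
  by case/andP => /allrelP h _; apply/allP => j js; apply: h => //; rewrite inE eqxx.
have s2P : all (fun j : 'I_n => (k < j)%N) s2.
  move: inc; rewrite /increasing (sorted_pairwise ltn_ord_trans) pairwise_cat.
  by case/and3P => _ _ /=; case/andP.
rewrite /pivot filter_cat /= ltnn.
rewrite (eq_in_filter (a1 := fun b : 'I_n => (b < k)%N) (a2 := pred0) (s := s2));
  last first.
  by move=> j /(allP s2P) /ltnW; rewrite leqNgt => /negPf.
rewrite filter_pred0 cats0 (all_filterP s1P).
rewrite prev_nth mem_cat inE eqxx orbT last_cat /=.
case: s1 kS1 {inc un s1P} => [_|b s1] /=.
  by rewrite (memNindex kS2) -last_nth.
rewrite inE negb_or => /andP[_ ks1].
by rewrite index_cat (negPf ks1) /= eqxx addn0 -cat_cons nth_cat /= ltnSn -last_nth.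
Qed.

Lemma block_cycle_next B k : block_cycle B k = next (enum B) k.
Proof. by rewrite permE. Qed.

Lemma mem_block_cycle B k : (block_cycle B k \in B) = (k \in B).
Proof. by rewrite block_cycle_next -!(mem_enum B) mem_next. Qed.

Lemma block_cycle_out B k : k \notin B -> block_cycle B k = k.
Proof. by move=> kB; rewrite block_cycle_next next_nth mem_enum (negPf kB). Qed.

Lemma block_cycle_pivot B k : k \in B -> pivot (enum B) (block_cycle B k) = k.
Proof.
move=> kB; rewrite pivot_prev ?increasing_enum ?mem_enum ?mem_block_cycle //.
by rewrite block_cycle_next prev_next ?enum_uniq.
Qed.

Lemma block_cycleVE B k :
  ((block_cycle B)^-1)%g k = if k \in B then pivot (enum B) k else k.
Proof.
apply: (canLR (permK _)); case: ifPn => [kB|/block_cycle_out //].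
rewrite pivot_prev ?increasing_enum ?mem_enum // block_cycle_next.
by rewrite next_prev ?enum_uniq.
Qed.

Lemma last_enum_const B k l : B != finset.set0 ->
  last k (enum B) = last l (enum B).
Proof. by rewrite -cards_eq0 cardE; case: (enum B). Qed.

Lemma delta_val k : delta n k = (if k.+1 < n then k.+1 else 0)%N :> nat.
Proof.
rewrite block_cycle_next next_nth mem_enum inE enum_setT -enumT.
case E: (enum 'I_n) => [|y t].
  by have := size_enum_ord n; have := ltn_ord k; rewrite E /=; lia.
have hy : y = 0%N :> nat.
  have n0 : (0 < n)%N by have := ltn_ord k; lia.
  by have := nth_enum_ord k n0; rewrite E.
rewrite -E index_enum_ord; case: ifP => [lt|/negbT].
  by have := nth_enum_ord y lt; rewrite E.
rewrite -leqNgt => le; rewrite nth_default ?hy //.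
by move: le (size_enum_ord n); rewrite E /=; lia.
Qed.

Lemma filter_ltS s k m : (m = k.+1)%N -> k \notin s ->
  [seq b : 'I_n <- s | (b < m)%N] = [seq b : 'I_n <- s | (b < k)%N].
Proof.
move=> -> ks; apply: eq_in_filter => b bs; rewrite ltnS leq_eqVlt.
by have /negPf : b != k by [apply: contraNneq ks => <-]; rewrite -val_eqE /= => ->.
Qed.

(** [delta] turns the circle by one step, so the vertices of [B] strictly before
    [delta k] are those weakly before [k]. *)
Lemma pivot_delta B k : B != finset.set0 ->
  pivot (enum B) (delta n k) = if k \in B then k else pivot (enum B) k.
Proof.
move=> B0; have inc := increasing_enum B.
have lastE j j' : last j (enum B) = last j' (enum B) by apply: last_enum_const.
have dk := delta_val k.
case: ltnP dk => [lt dk|le dk].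
  case: ifPn => kB; last first.
    rewrite /pivot (filter_ltS dk) ?mem_enum //.
    by rewrite (lastE (delta n k) k).
  rewrite /pivot dk; move: kB; rewrite -(mem_enum B) => kB.
  case/splitPr: kB inc => s1 s2.
  rewrite /increasing (sorted_pairwise ltn_ord_trans) pairwise_cat /=.
  case/and4P => _ _ s2P _.
  rewrite filter_cat /= ltnSn.
  rewrite (eq_in_filter (a1 := fun b : 'I_n => (b < k.+1)%N) (a2 := pred0)
    (s := s2)).
    by rewrite filter_pred0 last_cat.
  by move=> j /(allP s2P); rewrite leqNgt => /negPf.
(* Here k is the largest label and delta k = 0. *)
rewrite pivot_before; last by apply/allP => j _; rewrite dk.
have kmax j : (j <= k)%N by have := ltn_ord j; move: le; lia.
case: ifPn => kB; last first.
  rewrite pivot_after ?(lastE _ k) //; apply/allP => j; rewrite mem_enum => jB.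
  rewrite ltn_neqAle kmax andbT; apply: contraNneq kB => /val_inj <-; exact: jB.
move: kB inc; rewrite -(mem_enum B) => /splitPr[s1 s2].
rewrite /increasing (sorted_pairwise ltn_ord_trans) pairwise_cat /=.
case/and4P => _ _ s2P _; rewrite last_cat /=.
case: s2 s2P => //= b s2 /andP[]; have := kmax b; lia.
Qed.

End Pivot.

(** * The action of a block on configurations *)

(** The image of the configuration [p] under the block [s].  The first summand is
    the relabelling by the cycle [s], the pivot of a vertex being its predecessor
    in that cycle; the second is the translation of the gap of [k], which vanishes
    when the pivot of [k] is the last vertex of [s]. *)
Definition move (R : realType) (n : nat) (V : lmodType R) (q : R) (s : seq 'I_n)
    (p : 'I_n -> V) (k : 'I_n) : V :=
  p (if k \in s then pivot s k else k)
  + (1 - q) *: (p (last k s) - p (pivot s k)).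

Section Move.
Variables (R : realType) (n : nat) (V : lmodType R) (q : R).
Implicit Types (s : seq 'I_n) (i j k : 'I_n) (p : 'I_n -> V).

Lemma eq_move s p p' : p =1 p' -> move q s p =1 move q s p'.
Proof. by move=> e k; rewrite /move !e. Qed.

Lemma move_seq0 p : move q [::] p =1 p.
Proof. by move=> k; rewrite /move /pivot /= subrr scaler0 addr0. Qed.

Lemma move_seq1 i p : move q [:: i] p =1 p.
Proof.
move=> k; rewrite /move /pivot !inE /=.
have [->|] := eqVneq k i; first by case: ifP; rewrite /= subrr scaler0 addr0.
by case: ifP; rewrite /= subrr scaler0 addr0.
Qed.

Lemma move_before s p k : all (fun j : 'I_n => (k < j)%N) s -> move q s p k = p k.
Proof.
move=> /allP h; rewrite /move pivot_before; last by apply/allP => j /h /ltnW.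
rewrite subrr scaler0 addr0; case: ifP => // /h; by rewrite ltnn.
Qed.

Lemma move_head i s p : increasing (i :: s) -> move q (i :: s) p i = p (last i s).
Proof.
rewrite increasing_cons => /andP[/allP h _].
rewrite /move pivot_before; last by rewrite /= leqnn; apply/allP => j /h /ltnW.
by rewrite inE eqxx /= subrr scaler0 addr0.
Qed.

Lemma move_gap i j s p k : increasing [:: i, j & s] -> (i < k)%N -> (k <= j)%N ->
  move q [:: i, j & s] p k =
  p (if k == j then i else k) + (1 - q) *: (p (last j s) - p i).
Proof.
rewrite increasing_cons => /andP[_].
rewrite increasing_cons => /andP[/allP js _] ik kj.
have pE : pivot [:: i, j & s] k = i.
  rewrite pivot_cons // (eq_in_filter (a2 := pred0)) ?filter_pred0 //.
  by move=> b; rewrite inE => /orP[/eqP ->|/js]; rewrite /=; lia.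
rewrite /move pE /= !inE -!val_eqE /= (gtn_eqF ik) /=; congr (p _ + _).
case: eqP => //= kj'; case: ifP => // /js; lia.
Qed.

Lemma move_beyond i j s p k : increasing [:: i, j & s] -> (j < k)%N ->
  move q [:: i, j & s] p k = move q (j :: s) p k.
Proof.
rewrite increasing_cons /= => /andP[/andP[ij _] _] jk.
have ik : (i < k)%N by apply: ltn_trans jk.
rewrite /move (pivot_cons _ ik) (pivot_cons _ jk) /= jk /=.
by rewrite in_cons -val_eqE /= (gtn_eqF ik).
Qed.

(** After the block [j :: s] has acted, the label [j] carries the last vertex, while
    the labels before [j] are untouched.  So the action of the pair on the gap
    between [i] and [j] is the translation prescribed by the longer block. *)
Lemma move_cons i j s p : increasing [:: i, j & s] ->
  move q [:: i; j] (move q (j :: s) p) =1 move q [:: i, j & s] p.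
Proof.
move=> inc k.
have incs : increasing (j :: s) by move: inc; rewrite increasing_cons => /andP[].
have ij : (i < j)%N by move: inc; rewrite increasing_cons /= => /andP[/andP[]].
have inc2 : increasing [:: i; j] by rewrite /increasing /= ij.
have rB (m : 'I_n) : (m < j)%N -> move q (j :: s) p m = p m.
  move=> mj; apply: move_before; rewrite /= mj.
  move: incs; rewrite increasing_cons => /andP[/allP h _].
  by apply/allP => b /h; apply: ltn_trans.
have rj := move_head p incs.
have [ki|ik|/val_inj ->] := ltngtP k i.
- have kj := ltn_trans ki ij.
  have ks : all (fun b : 'I_n => (k < b)%N) s.
    move: incs; rewrite increasing_cons => /andP[/allP h _].
    by apply/allP => b /h; apply: ltn_trans.
  by rewrite [RHS]move_before ?[LHS]move_before /= ?ki ?kj ?rB.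
- have [kj'|jk] := leqP k j.
    rewrite !move_gap //= rj (rB i) //; congr (_ + _).
    case: eqP => [_|/eqP ne]; first exact: rB.
    by apply: rB; rewrite ltn_neqAle kj' andbT.
  by rewrite !move_beyond // move_seq1.
- by rewrite !move_head //=.
Qed.

(** The dual braid relation s_ij s_ik = s_ik s_kj; by [move_cons] both sides are
    the action of the triangle i < k < j. *)
Lemma move_conj i k j p : (i < k)%N -> (k < j)%N ->
  move q [:: i; j] (move q [:: i; k] p) =1 move q [:: i; k; j] p.
Proof.
move=> ik kj m; have ij := ltn_trans ik kj.
have inc2 : increasing [:: i; j] by rewrite /increasing /= ij.
have inc1 : increasing [:: i; k] by rewrite /increasing /= ik.
have inc3 : increasing [:: i; k; j] by rewrite /increasing /= ik kj.
have aft (l : 'I_n) : (k < l)%N -> move q [:: i; k] p l = p l.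
  by move=> kl; rewrite move_beyond // move_seq1.
have [mi|im|/val_inj ->] := ltngtP m i.
- by rewrite !move_before //= mi ?(ltn_trans mi) //.
- have [mk|km] := leqP m k.
    rewrite [RHS]move_gap //= [LHS]move_gap //=; last by lia.
    have mj : (m == j) = false by rewrite -val_eqE /= ltn_eqF // (leq_ltn_trans mk).
    rewrite mj (aft j) // move_head // move_gap //= -addrA -scalerDr.
    by congr (_ + _ *: _); rewrite addrC addrA subrK.
  have [mj|jm] := leqP m j.
    rewrite [RHS]move_beyond // [LHS]move_gap //= [RHS]move_gap //=; last first.
      by rewrite /increasing /= kj.
    rewrite (aft j) // move_head //=; case: eqP => [_|_]; last by rewrite aft.
    by rewrite move_head.
  by rewrite !move_beyond ?move_seq1 ?aft // /increasing /= kj.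
- by rewrite !move_head //= aft.
Qed.

End Move.

(** * The simplicial representation through the Burau matrices *)

Section Burau.
Variables (R : realType) (n : nat).
Implicit Types (p : 'I_n -> 'rV[R]_n.-1) (Q : 'M[R]_n) (M : 'M[R]_(nedges n)).

Definition transform Q p (k : 'I_n) : 'rV[R]_n.-1 := row k Q *m \matrix_i p i.

Lemma transform1 p : transform 1%:M p = p.
Proof. by apply/funext => k; rewrite /transform row1 -rowE rowK. Qed.

Lemma transformM Q Q' p : transform (Q *m Q') p = transform Q (transform Q' p).
Proof.
apply/funext => k; rewrite /transform row_mul -mulmxA; congr (_ *m _).
by apply/row_matrixP => i; rewrite row_mul rowK.
Qed.

Definition burau q (s : seq 'I_n) : 'M[R]_n :=
  \matrix_k move q s (fun i => delta_mx 0 i : 'rV[R]_n) k.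

Lemma row_burau_mul m q s (X : 'M[R]_(n, m)) k :
  row k (burau q s) *m X = move q s (fun i => row i X) k.
Proof.
by rewrite rowK /move mulmxDl -scalemxAl mulmxBl -!rowE.
Qed.

Lemma transform_burau q s p : transform (burau q s) p =1 move q s p.
Proof.
by move=> k; rewrite /transform row_burau_mul; apply: eq_move => i; rewrite rowK.
Qed.

Lemma row_burau2 q s s' k : row k (burau q s *m burau q s') =
  move q s (move q s' (fun i => delta_mx 0 i : 'rV[R]_n)) k.
Proof.
by rewrite row_mul row_burau_mul; apply: eq_move => i; rewrite rowK.
Qed.

Lemma sqdistC (x y : 'rV[R]_n.-1) : sqdist x y = sqdist y x.
Proof. by apply: eq_bigr => i _; rewrite -sqrrN opprB. Qed.

Lemma sqdistxx (x : 'rV[R]_n.-1) : sqdist x x = 0.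
Proof. by rewrite /sqdist big1 // => i _; rewrite subrr expr0n. Qed.

Lemma bas_edge_norms k l p :
  bas R k l *m edge_norms p = (sqdist (p k) (p l))%:M.
Proof.
have lt (i j : 'I_n) : (i < j)%N ->
    bas R i j *m edge_norms p = (sqdist (p i) (p j))%:M.
  move=> ij; pose e : edge n := Sub (i, j) ij.
  rewrite -[i]/((val e).1) -[j]/((val e).2) bas_delta -rowE.
  by apply/matrixP => a b; rewrite !mxE enum_rankK !ord1 eqxx mulr1n.
have [kl|lk|/val_inj ->] := ltngtP k l; first exact: lt.
  by rewrite basC sqdistC lt.
have -> : bas R l l = 0.
  apply/rowP => a; rewrite !mxE orbb; case: eqP => //= e.
  by have := valP (enum_val a); rewrite /= e ltnn.
by rewrite mul0mx sqdistxx raddf0.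
Qed.

Lemma edge_norms_ext (c c' : 'cV[R]_(nedges n)) :
  (forall k l, k != l -> bas R k l *m c = bas R k l *m c') -> c = c'.
Proof.
move=> h; apply/row_matrixP => a; rewrite !rowE.
rewrite -(enum_valK a) -bas_delta; apply: h.
by have := valP (enum_val a); rewrite -val_eqE neq_ltn => ->.
Qed.

(** [M] describes on edge norms what the linear map [Q] does to points.  That [Q]
    has row sums 1 makes it compatible with translations, and invertibility makes
    it preserve affine independence. *)
Definition realizes M Q : Prop :=
  [/\ Q \in unitmx, Q *m const_mx 1 = const_mx 1 :> 'cV[R]_n
    & forall p, M *m edge_norms p = edge_norms (transform Q p)].

Lemma realizes1 : realizes 1%:M 1%:M.
Proof. by split=> [||p]; rewrite ?unitmx1 ?mul1mx ?transform1. Qed.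

Lemma realizesM M M' Q Q' :
  realizes M Q -> realizes M' Q' -> realizes (M *m M') (Q *m Q').
Proof.
move=> [u s e] [u' s' e']; split=> [||p].
- by rewrite unitmx_mul u.
- by rewrite -mulmxA s' s.
- by rewrite -mulmxA e' e transformM.
Qed.

Lemma realizesV M Q : M \in unitmx -> realizes M Q -> realizes (invmx M) (invmx Q).
Proof.
move=> uM [u s e]; split=> [||p].
- by rewrite unitmx_inv.
- by rewrite -[in LHS]s mulKmx.
- have := e (transform (invmx Q) p); rewrite -transformM mulmxV // transform1.
  by move=> <-; rewrite mulKmx.
Qed.

Lemma burau_sum1 q s : burau q s *m const_mx 1 = const_mx 1 :> 'cV[R]_n.
Proof.
apply/row_matrixP => k; rewrite row_mul row_burau_mul /move !row_const.
by rewrite subrr scaler0 addr0.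
Qed.

Lemma burau_pair_unit (q : R) (i j : 'I_n) : q != 0 -> (i < j)%N ->
  burau q [:: i; j] \in unitmx.
Proof.
move=> q0 ij; rewrite -row_full_unit -sub1mx; apply/row_subP => k; rewrite row1.
have inc : increasing [:: i; j] by rewrite /increasing /= ij.
have sub (l : 'I_n) : (row l (burau q [:: i; j]) <= burau q [:: i; j])%MS.
  exact: row_sub.
have sj : ((delta_mx 0 j : 'rV[R]_n) <= burau q [:: i; j])%MS.
  by have := sub i; rewrite rowK move_head.
have si : ((delta_mx 0 i : 'rV[R]_n) <= burau q [:: i; j])%MS.
  (* The row of j is q e_i + (1 - q) e_j, and e_j is the row of i. *)
  have := sub j; rewrite rowK move_gap // eqxx /= => h.
  have -> : delta_mx 0 i = q^-1 *: (delta_mx 0 i + (1 - q) *: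
      (delta_mx 0 j - delta_mx 0 i) - (1 - q) *: delta_mx 0 j) :> 'rV[R]_n.
    by apply/rowP => a; rewrite !mxE; field.
  by rewrite scalemx_sub // addmx_sub // eqmx_opp scalemx_sub.
have [->//|kj] := eqVneq k j; have [->//|ki] := eqVneq k i.
have := sub k; rewrite rowK /move !inE (negPf ki) (negPf kj) /= => h.
rewrite -[delta_mx 0 k](addrK
  ((1 - q) *: (delta_mx 0 j - delta_mx 0 (pivot [:: i; j] k)))).
have : ((delta_mx 0 (pivot [:: i; j] k) : 'rV[R]_n) <= burau q [:: i; j])%MS.
  have := @pivot_mem n [:: i; j] k isT.
  by rewrite !inE => /orP[] /eqP ->.
by move=> sp; rewrite addmx_sub // eqmx_opp scalemx_sub // addmx_sub // eqmx_opp.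
Qed.

(** Stewart's formula for the distance from [z] to a point of the line [x y].  The
    row of the simplicial representation with three terms is this formula with
    x = p_i, y = p_j and z = p_k. *)
Lemma stewart q (x y z : 'rV[R]_n.-1) :
  sqdist (x + (1 - q) *: (y - x)) z =
  (q ^+ 2 - q) * sqdist y x + q * sqdist x z + (1 - q) * sqdist y z.
Proof.
rewrite /sqdist !mulr_sumr -!big_split /=; apply: eq_bigr => i _.
by rewrite !mxE; ring.
Qed.

(** The five kinds of rows of a generator are the squared distances between the
    points of the moved configuration, in which p_i and p_j are replaced by p_j and
    p_i + (1 - q)(p_j - p_i). *)
Lemma realizes_gen (q : R) (g : 'I_n.-1) : q != 0 ->
  realizes (S_gen q g) (burau q [:: gen_fst g; gen_snd g]).
Proof.
move=> q0; have lt : (gen_fst g < gen_snd g)%N by [].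
split; [exact: burau_pair_unit | exact: burau_sum1 | move=> p].
have inc : increasing [:: gen_fst g; gen_snd g] by rewrite /increasing /= ltnSn.
have -> : transform (burau q [:: gen_fst g; gen_snd g]) p =
    move q [:: gen_fst g; gen_snd g] p by apply/funext; apply: transform_burau.
have [Sij Sout Si Sj] := S_gen_acts q g.
set i := gen_fst g in lt inc Sij Sout Si Sj *.
set j := gen_snd g in lt inc Sij Sout Si Sj *.
have mi : move q [:: i; j] p i = p j by rewrite move_head.
have mj : move q [:: i; j] p j = p i + (1 - q) *: (p j - p i).
  by rewrite move_gap // eqxx.
have mo m : m \notin [:: i; j] -> move q [:: i; j] p m = p m.
  move=> mo; have [mi'|im] := ltnP m i.
    by apply: move_before; rewrite /= mi' (ltn_trans mi').
  have jm : (j < m)%N.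
    move: mo im; rewrite !inE negb_or -!val_eqE /=; lia.
  by rewrite move_beyond // move_seq1.
apply: edge_norms_ext => k l kl; rewrite mulmxA.
have Ei m : m \notin [:: i; j] ->
    bas R i m *m S_gen q g *m edge_norms p =
    bas R i m *m edge_norms (move q [:: i; j] p).
  by move=> mo'; rewrite Si // !bas_edge_norms mi mo.
have Ej m : m \notin [:: i; j] ->
    bas R j m *m S_gen q g *m edge_norms p =
    bas R j m *m edge_norms (move q [:: i; j] p).
  move=> mo'; rewrite Sj // !mulmxDl -!scalemxAl !bas_edge_norms mj mo // stewart.
  by rewrite !scale_scalar_mx -!raddfD /= (sqdistC (p i) (p j)).
have Eij : bas R i j *m S_gen q g *m edge_norms p =
    bas R i j *m edge_norms (move q [:: i; j] p).
  rewrite Sij -scalemxAl !bas_edge_norms mi mj.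
  rewrite [in RHS]sqdistC stewart scale_scalar_mx.
  congr (_%:M); rewrite (sqdistC (p j) (p i)).
  by rewrite sqdistxx; ring.
have [ki|ki] := boolP (k \in [:: i; j]); have [li|li] := boolP (l \in [:: i; j]).
- move: ki li kl; rewrite !inE => /orP[] /eqP -> /orP[] /eqP ->; rewrite ?eqxx //.
  by rewrite basC.
- by move: ki; rewrite !inE => /orP[] /eqP ->; [apply: Ei | apply: Ej].
- by rewrite basC; move: li; rewrite !inE => /orP[] /eqP ->; [apply: Ei | apply: Ej].
- by rewrite Sout // !bas_edge_norms !mo.
Qed.

End Burau.

(** * Dual simple braids *)

Section DualSimpleAction.
Variables (R : realType) (n : nat) (q : R).
Hypothesis q0 : q != 0.
Implicit Types (p : 'I_n -> 'rV[R]_n.-1) (s : seq 'I_n) (B C : {set 'I_n}).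

Lemma burau_cons (i j : 'I_n) s : increasing [:: i, j & s] ->
  burau q [:: i; j] *m burau q (j :: s) = burau q [:: i, j & s].
Proof.
by move=> inc; apply/row_matrixP => k; rewrite row_burau2 rowK move_cons.
Qed.

Lemma burau_conj (i k j : 'I_n) : (i < k)%N -> (k < j)%N ->
  burau q [:: i; j] *m burau q [:: i; k] = burau q [:: i; k] *m burau q [:: k; j].
Proof.
move=> ik kj; rewrite burau_cons /increasing /= ?ik ?kj //.
by apply/row_matrixP => m; rewrite row_burau2 rowK move_conj.
Qed.

Lemma s_pair_next (i j : 'I_n) : j = i.+1 :> nat -> s_pair i j = s_std n i.
Proof. by move=> ji; rewrite /s_pair ji big_geq // mul1g invg1 mulg1. Qed.

Lemma s_pair_conj (i k j : 'I_n) : k = i.+1 :> nat -> (k < j)%N ->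
  s_pair i j = (s_std n i * s_pair k j * (s_std n i)^-1)%g.
Proof.
move=> ki kj; have ij : (i < j.-1)%N by lia.
by rewrite /s_pair big_ltn // ki invMg !mulgA.
Qed.

(** Induction on [j - i]: s_ij is the conjugate of s_(i+1)j by s_i(i+1), and so are
    the Burau matrices by [burau_conj]. *)
Lemma realizes_s_pair (i j : 'I_n) : (i < j)%N ->
  realizes (simplicial_rep q (s_pair i j)) (burau q [:: i; j]).
Proof.
move=> ij; have [d] := ubnP (j - i)%N; elim: d i ij => [|d IH] i ij; first by lia.
move=> dE.
have lti : (i < n.-1)%N by have := ltn_ord j; lia.
have [k kE] : exists k : 'I_n, k = i.+1 :> nat by exists (gen_snd (Ordinal lti)).
have gen : realizes (simplicial_rep q (s_std n i)) (burau q [:: i; k]).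
  have := realizes_gen (Ordinal lti) q0.
  have -> : gen_fst (Ordinal lti) = i by apply: val_inj.
  have -> : gen_snd (Ordinal lti) = k by apply: val_inj.
  by rewrite -(simplicial_rep_s_std _ q0).
have [kj|jk] := ltnP k j; last first.
  have <- : k = j by apply: val_inj; rewrite /= kE; move: jk; rewrite kE; lia.
  by rewrite (s_pair_next kE).
have ik : (i < k)%N by rewrite kE.
have uQ : burau q [:: i; k] \in unitmx by exact: burau_pair_unit.
rewrite (s_pair_conj kE kj) 2!(simplicial_repM _ _ q0).
rewrite -(mulmxK uQ (burau q [:: i; j])) (burau_conj ik kj).
have -> : simplicial_rep q (s_std n i)^-1%g = invmx (simplicial_rep q (s_std n i)).
  have u := simplicial_rep_unit (s_std n i) q0.
  rewrite -[RHS]mulmx1 -(simplicial_rep1 n q0) -(mulgV (s_std n i)).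
  by rewrite simplicial_repM // mulKmx.
apply: realizesM; last by apply: realizesV => //; apply: simplicial_rep_unit.
apply: (realizesM gen); apply: (IH _ kj); move: dE kj; rewrite kE; lia.
Qed.

Lemma realizes_chain s : increasing s ->
  realizes (simplicial_rep q (\prod_(p <- zip s (behead s)) s_pair p.1 p.2)%g)
           (burau q s).
Proof.
elim: s => [_|i [_ _|j s IH inc]].
- have -> : burau q [::] = 1%:M :> 'M_n.
    by apply/row_matrixP => k; rewrite rowK move_seq0 row1.
  by rewrite big_nil simplicial_rep1 //; apply: realizes1.
- have -> : burau q [:: i] = 1%:M :> 'M_n.
    by apply/row_matrixP => k; rewrite rowK move_seq1 row1.
  by rewrite big_nil simplicial_rep1 //; apply: realizes1.
- rewrite /= big_cons simplicial_repM // -burau_cons //.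
  move: inc; rewrite increasing_cons /= => /andP[/andP[ij _] inc].
  by apply: realizesM; [apply: realizes_s_pair | apply: IH].
Qed.

Lemma realizes_s_block B :
  realizes (simplicial_rep q (s_block B)) (burau q (enum B)).
Proof. exact/realizes_chain/increasing_enum. Qed.

End DualSimpleAction.

(** Equality of the pivots expresses that [C] lies in a single gap of [B]. *)
Definition uncrossed n (B C : {set 'I_n}) : Prop :=
  [disjoint B & C] /\ {in C &, forall c c', pivot (enum B) c = pivot (enum B) c'}.

Section ManyBlocks.
Variables (R : realType) (n : nat) (q : R).
Hypothesis q0 : q != 0.
Implicit Types (p : 'I_n -> 'rV[R]_n.-1) (B C : {set 'I_n}).
Implicit Types (t : seq {set 'I_n}).

(** The second summand of [move], which adds up over the blocks of a partition. *)
Definition drift B p k : 'rV[R]_n.-1 :=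
  (1 - q) *: (p (last k (enum B)) - p (pivot (enum B) k)).

Lemma drift_const B C p k l : B != finset.set0 ->
  uncrossed B C -> k \in C -> l \in C -> drift B p k = drift B p l.
Proof.
by move=> B0 [_ gap] kC lC; rewrite /drift (gap _ _ kC lC) (last_enum_const k l).
Qed.

Definition noncrossing_family t : Prop :=
  [/\ uniq t, {in t, forall B, B != finset.set0}
    & {in t &, forall B C, B != C -> uncrossed B C}].

Lemma noncrossing_family_cons B t : noncrossing_family (B :: t) ->
  [/\ noncrossing_family t, B != finset.set0
    & {in t, forall C, [/\ uncrossed B C, uncrossed C B & C != finset.set0]}].
Proof.
move=> [/= /andP[Bt un] ne nc].
have ne' C : C \in t -> C != finset.set0.
  by move=> Ct; apply: ne; rewrite inE Ct orbT.
split=> [||C Ct]; [split=> // | by apply: ne; rewrite inE eqxx |].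
  by move=> C D Ct Dt; apply: nc; rewrite inE ?Ct ?Dt orbT.
have CB : C != B by apply: contraNneq Bt => <-.
split; [apply: nc|apply: nc|apply: ne'] => //;
  by rewrite ?inE ?eqxx ?Ct ?orbT // eq_sym.
Qed.

Lemma prod_block_cycle_out t k : {in t, forall C, k \notin C} ->
  (\prod_(C <- t) block_cycle C)%g k = k.
Proof.
elim: t => [_|C t IH h]; first by rewrite big_nil perm1.
rewrite big_cons permM block_cycle_out ?h ?inE ?eqxx // IH // => D Dt.
by apply: h; rewrite inE Dt orbT.
Qed.

Lemma prod_block_cycle_in t B k : noncrossing_family t -> B \in t -> k \in B ->
  (\prod_(C <- t) block_cycle C)%g k = block_cycle B k.
Proof.
elim: t => // C t IH /noncrossing_family_cons[nf _ nC].
rewrite inE big_cons permM => /orP[/eqP ->|Bt] kB.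
  apply: prod_block_cycle_out => D /nC[[dis _] _ _].
  by rewrite (disjointFr dis) ?mem_block_cycle.
have [[dis _] _ _] := nC _ Bt.
by rewrite block_cycle_out ?IH // (disjointFl dis kB).
Qed.

(** The head block comes first in the product of permutations, which compose from
    left to right, but acts last on points, where matrices compose from right to
    left.  The two orders agree because disjoint cycles commute. *)
Lemma prod_block_cycleV_cons B t k :
  {in t, forall C, [disjoint B & C]} ->
  let f := (\prod_(C <- t) block_cycle C)%g in
  ((block_cycle B * f)^-1)%g k = (f^-1)%g ((block_cycle B)^-1%g k).
Proof.
move=> dis f; rewrite invMg permM.
have fB j : j \in B -> f j = j.
  by move=> jB; apply: prod_block_cycle_out => C /dis d; rewrite (disjointFr d jB).
have fVB j : j \in B -> (f^-1)%g j = j by move=> /fB e; rewrite -{1}e permK.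
have bV j : ((block_cycle B)^-1%g j \in B) = (j \in B).
  by rewrite -{2}(permKV (block_cycle B) j) mem_block_cycle.
have bo j : j \notin B -> (block_cycle B)^-1%g j = j.
  by move=> /negPf jB; rewrite block_cycleVE jB.
have [kB|kB] := boolP (k \in B); first by rewrite !fVB ?bV.
rewrite (bo k) // bo //; apply: contraNN kB => fk.
by rewrite -(permKV f k) fB.
Qed.

(** Drifts of uncrossed blocks add up: the blocks that acted before [B] translated
    all its vertices by the same vector, which cancels in the drift of [B], and
    they are constant along the cycle of [B]. *)
Lemma realizes_family t : noncrossing_family t ->
  exists2 Q, realizes (simplicial_rep q (\prod_(B <- t) s_block B)%g) Q
  & forall p k, transform Q p k =
      p ((\prod_(B <- t) block_cycle B)^-1 k)%g + \sum_(B <- t) drift B p k.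
Proof.
elim: t => [_|B t IH /noncrossing_family_cons[nf B0 nB]].
  exists 1%:M; first by rewrite big_nil simplicial_rep1 //; apply: realizes1.
  by move=> p k; rewrite transform1 !big_nil invg1 perm1 addr0.
have [Q rQ Qp] := IH nf; exists (burau q (enum B) *m Q).
  by rewrite big_cons simplicial_repM //; apply: realizesM => //; apply: realizes_s_block.
move=> p k; rewrite transformM transform_burau /move !big_cons.
rewrite prod_block_cycleV_cons; last by move=> C /nB[[]].
rewrite mem_enum -block_cycleVE.
set f := (\prod_(C <- t) block_cycle C)%g.
have fVB j : j \in B -> (f^-1)%g j = j.
  move=> jB; apply: (canLR (permK _)).
  rewrite prod_block_cycle_out // => C /nB[[d _] _ _].
  by rewrite (disjointFr d jB).
have dB j l : j \in B -> l \in B ->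
    \sum_(C <- t) drift C p j = \sum_(C <- t) drift C p l.
  move=> jB lB; apply: eq_big_seq => C Ct; have [_ CB C0] := nB _ Ct.
  exact: drift_const CB jB lB.
have Ne : enum B != [::] by rewrite -size_eq0 -cardE cards_eq0.
have pB : pivot (enum B) k \in B by rewrite -mem_enum pivot_mem.
have lB : last k (enum B) \in B.
  by rewrite -mem_enum; case: (enum B) Ne => //= b s _; rewrite mem_last.
rewrite !Qp (fVB _ pB) (fVB _ lB) (dB _ _ lB pB) -/(drift B p k).
rewrite opprD addrACA subrr addr0 -/(drift B p k) -addrA [drift B p k + _]addrC.
congr (_ + (_ + _)); rewrite block_cycleVE; case: ifP => // kB; exact: dB.
Qed.

End ManyBlocks.

(** * Edge norms determine matrices *)

Section Rescaling.
Variables (R : realType) (n : nat).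
Implicit Types (p : 'I_n -> 'rV[R]_n.-1) (Q : 'M[R]_n) (M : 'M[R]_(nedges n)).
Implicit Types (sigma tau : {set {set 'I_n}}).

Lemma transform_affinely_independent Q p :
  Q \in unitmx -> Q *m const_mx 1 = const_mx 1 :> 'cV[R]_n ->
  affinely_independent p -> affinely_independent (transform Q p).
Proof.
move=> uQ Q1 ap c c0 cp.
pose u : 'rV[R]_n := \row_i c i.
have uE (X : 'M[R]_(n, n.-1)) : u *m X = \sum_i c i *: row i X.
  by rewrite mulmx_sum_row; apply: eq_bigr => i _; rewrite mxE.
have u1 (v : 'rV[R]_n) : (v *m (const_mx 1 : 'cV[R]_n)) 0 0 = \sum_i v 0 i.
  by rewrite mxE; apply: eq_bigr => i _; rewrite mxE mulr1.
have uQ0 k : (u *m Q) 0 k = 0.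
  apply: (ap (fun k => (u *m Q) 0 k)).
    by rewrite -u1 -mulmxA Q1 u1 -[RHS]c0; apply: eq_bigr => i _; rewrite mxE.
  transitivity (u *m Q *m \matrix_i p i).
    by rewrite [RHS]mulmx_sum_row; apply: eq_bigr => i _; rewrite rowK.
  by rewrite -mulmxA uE -[RHS]cp; apply: eq_bigr => i _; rewrite row_mul.
have /rowP z : u = 0.
  rewrite -(mulmxK uQ u) (_ : u *m Q = 0) ?mul0mx //.
  by apply/rowP => k; rewrite uQ0 mxE.
by move=> k; have := z k; rewrite !mxE.
Qed.

Lemma edge_norms_translate p p' :
  (forall k l, p' k - p k = p' l - p l) -> edge_norms p' = edge_norms p.
Proof.
move=> h; apply/colP => a; rewrite !mxE /=; apply: eq_bigr => i _.
have /rowP/(_ i) := h (val (enum_val a)).1 (val (enum_val a)).2.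
by rewrite !mxE => e; congr (_ ^+ 2); move: e; lra.
Qed.

End Rescaling.

Section Spanning.
Variable (R : realType).

Lemma bas_pairing n (a b k l : 'I_n) : a != b ->
  bas R a b *m (bas R k l)^T = (((a, b) == (k, l)) || ((a, b) == (l, k)))%:R%:M.
Proof.
have lt (i j : 'I_n) : (i < j)%N ->
    bas R i j *m (bas R k l)^T = (((i, j) == (k, l)) || ((i, j) == (l, k)))%:R%:M.
  move=> ij; pose e : edge n := Sub (i, j) ij.
  rewrite -[i in bas R i]/((val e).1) -[j in bas R _ j]/((val e).2) bas_delta -rowE.
  by apply/matrixP => x y; rewrite !mxE enum_rankK !ord1 eqxx mulr1n.
rewrite -val_eqE neq_ltn => /orP[/lt //|/lt ba].
by rewrite basC ba !xpair_eqE orbC [(b == l) && _]andbC [(b == k) && _]andbC.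
Qed.

(** The vertices other than [l] are the standard basis vectors, and [l] is placed on
    the axis of the vertex [k].  Replacing [x] by [- x] changes no edge norm but that
    of the edge [k l], and the simplex degenerates only when x = 1. *)
Definition probe n (k l : 'I_n.+1) (x : R) (m : 'I_n.+1) : 'rV[R]_n :=
  if unlift l m is Some j then delta_mx 0 j
  else if unlift l k is Some j then x *: delta_mx 0 j else 0.

Lemma probe_affinely_independent n (k l : 'I_n.+1) x : k != l -> x != 1 ->
  affinely_independent (n := n.+1) (probe k l x).
Proof.
move=> kl x1 c; rewrite !(bigD1_ord l) //= => c0.
case: (@unlift_some _ l k) => [|i kE uk]; first by rewrite eq_sym.
rewrite /probe unlift_none uk => cp.
(* Besides the vertex lift l j, only l can have a nonzero coordinate j. *)
have ci j : c (lift l j) = - (c l * x) *+ (j == i).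
  have := congr1 (fun v : 'rV[R]_n => v 0 j) cp; rewrite !mxE summxE.
  rewrite (bigD1 j) //= big1 => [|a aj].
    rewrite liftK !mxE !eqxx mulr1 addr0 => /eqP.
    rewrite addrC addr_eq0 => /eqP ->.
    by case: eqP => _; rewrite ?mulr1 ?mulr0 ?oppr0.
  by rewrite liftK !mxE eqxx /= eq_sym (negPf aj) mulr0.
have cl : c l = 0.
  move: c0; rewrite (bigD1 i) //= big1 => [|a ai]; last by rewrite ci (negPf ai).
  rewrite ci eqxx mulr1n addr0 => /eqP.
  rewrite -{1}[c l]mulr1 -mulrBr mulf_eq0 subr_eq0 [1 == x]eq_sym (negPf x1) orbF.
  by move/eqP.
move=> m; case: (unliftP l m) => [j ->|-> //].
by rewrite ci cl mul0r oppr0 mul0rn.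
Qed.

Lemma probe_edge_norms n (k l : 'I_n.+1) : k != l ->
  edge_norms (n := n.+1) (probe k l 2) - edge_norms (n := n.+1) (probe k l (- 2))
    = (- 8) *: (bas R k l)^T.
Proof.
move=> kl.
case: (@unlift_some _ l k) => [|i kE uk]; first by rewrite eq_sym.
have sqE x (j : 'I_n) : sqdist (n := n.+1) (x *: delta_mx 0 i) (delta_mx 0 j)
    = (if j == i then (x - 1) ^+ 2 else x ^+ 2 + 1 : R).
  rewrite /sqdist; case: eqP => [->|/eqP ji].
    rewrite (bigD1 i) //= big1 => [|a ai]; rewrite !mxE ?eqxx /= ?(negPf ai).
      by rewrite addr0 mulr1.
    by rewrite mulr0 subrr expr0n.
  rewrite (bigD1 i) //= (bigD1 j) //= big1 => [|a /andP[ai aj]].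
    rewrite !mxE !eqxx /= (negPf ji) [i == j]eq_sym (negPf ji) /=; ring.
  by rewrite !mxE /= (negPf ai) (negPf aj) mulr0 subrr expr0n.
have pl x : probe k l x l = x *: delta_mx 0 i by rewrite /probe unlift_none uk.
have po x j : probe k l x (lift l j) = delta_mx 0 j by rewrite /probe liftK.
apply: edge_norms_ext => a b ab; rewrite mulmxBr !bas_edge_norms -scalemxAr.
rewrite bas_pairing // scale_scalar_mx -raddfB /=; congr (_%:M); rewrite !xpair_eqE.
have ln j : (l == lift l j) = false by apply: negPf; apply: neq_lift.
have nl j : (lift l j == l) = false by rewrite eq_sym.
case: (unliftP l a) ab => [j ->|->] ab; case: (unliftP l b) ab => [j' ->|->] ab.
- by rewrite !po subrr !nl !andbF mulr0.
- rewrite !po !pl ![sqdist (delta_mx 0 j) _]sqdistC !sqE kE (inj_eq lift_inj).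
  by rewrite nl ln eqxx andbT orbF; case: eqP => _ /=; ring.
- rewrite !po !pl !sqE kE (inj_eq lift_inj) nl ln eqxx /=.
  by case: eqP => _ /=; ring.
- by rewrite eqxx in ab.
Qed.

End Spanning.

Lemma edge_norms_span (R : realType) n (M M' : 'M[R]_(nedges n)) :
  (forall p, affinely_independent p -> M *m edge_norms p = M' *m edge_norms p) ->
  M = M'.
Proof.
case: n M M' => [|n] M M' h.
  by apply: bas_inj => -[].
apply: trmx_inj; apply: bas_inj => k l kl; apply: trmx_inj.
rewrite !trmx_mul !trmxK.
have c0 : - 8 != 0 :> R by rewrite oppr_eq0 pnatr_eq0.
apply: (scalerI c0); rewrite !scalemxAr -probe_edge_norms // !mulmxBr.
have x2 : 2 != 1 :> R by apply/eqP; lra.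
have x2' : - 2 != 1 :> R by apply/eqP; lra.
by rewrite !h //; apply: probe_affinely_independent.
Qed.

(** Connectedness of the hypergraph formed by [sigma] and [tau], in the form in which
    it is used: a displacement that is constant on each hyperedge is a translation. *)
Definition jointly_connect (R : realType) n (sigma tau : {set {set 'I_n}}) : Prop :=
  forall e : 'I_n -> 'rV[R]_n.-1,
    (forall B k l, B \in sigma :|: tau -> k \in B -> l \in B -> e k = e l) ->
    forall k l, e k = e l.

(** * The rescaling matrix *)

(** Any two rescalings of [p] differ by a translation, so [M] is correct on every
    pair of simplices; and every matrix that is correct agrees with [M] on the edge
    norms of all nondegenerate simplices, since [Q] keeps them nondegenerate. *)
Lemma rescaling_mxE (R : realType) n (q : R) (sigma tau : {set {set 'I_n}}) M Q :
  jointly_connect R sigma tau -> realizes M Q ->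
  (forall p, rescaled q sigma tau p (transform Q p)) ->
  rescaling_mx q sigma tau = M.
Proof.
move=> conn [uQ Q1 MQ] resc; apply: xget_unique => [p p' _ _ [ps pt]|M' M'resc].
  rewrite MQ; apply: edge_norms_translate; apply: conn => B k l.
  have [rs rt] := resc p.
  suff diff (x y u v : 'rV[R]_n.-1) : x - y = u - v -> v - y = u - x.
    rewrite inE => /orP[Bs|Bt] kB lB; apply: diff.
      by rewrite (ps _ _ _ Bs kB lB) (rs _ _ _ Bs kB lB).
    by rewrite (pt _ _ _ Bt kB lB) (rt _ _ _ Bt kB lB).
  by move=> /rowP h; apply/rowP => i; move: (h i); rewrite !mxE; lra.
apply: edge_norms_span => p ap; rewrite MQ; apply: M'resc => //.
exact: transform_affinely_independent.
Qed.

(** * Noncrossing partitions *)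

Lemma segment_hull (R : realType) n (pt : 'I_n -> 'rV[R]_2) (B : {set 'I_n}) a c x y :
  a \in B -> c \in B -> a != c -> 0 <= x -> 0 <= y -> x + y = 1 ->
  conv_hull pt B (x *: pt a + y *: pt c).
Proof.
move=> aB cB ac x0 y0 xy.
pose w i := if i == a then x else if i == c then y else 0.
have sumE (V : lmodType R) (F : 'I_n -> V) :
    \sum_i w i *: F i = x *: F a + y *: F c.
  rewrite (bigD1 a) //= (bigD1 c) 1?eq_sym //= big1 => [|i /andP[ia ic]].
    by rewrite /w eqxx [c == a]eq_sym (negPf ac) eqxx addr0.
  by rewrite /w (negPf ia) (negPf ic) scale0r.
exists w; split; last by rewrite sumE.
- by move=> i; rewrite /w; case: eqP => // _; case: eqP.
- move=> i iB; rewrite /w.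
  by case: eqP iB => [->|_]; [rewrite aB | case: eqP => [->|//]; rewrite cB].
- have := sumE R^o (fun _ => 1).
  by rewrite (eq_bigr w) => [->|i _]; rewrite /GRing.scale /= ?mulr1.
Qed.

(** The barycentric weights of the crossing point are ratios of signed areas of the
    four triangles; these areas are all negative, and those of the two triangles on
    either side of a diagonal have the same sum for both diagonals. *)
Lemma diagonals_cross (R : realType) n (pt : 'I_n -> 'rV[R]_2) (B C : {set 'I_n})
    (a b c d : 'I_n) : clockwise pt -> (a < b)%N -> (b < c)%N -> (c < d)%N ->
  a \in B -> b \in C -> c \in B -> d \in C ->
  (conv_hull pt B `&` conv_hull pt C)%classic <> classical_sets.set0.
Proof.
move=> cw ab bc cd aB bC cB dC.
have ac := ltn_trans ab bc; have bd := ltn_trans bc cd; have ad := ltn_trans ab bd.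
have neq (i j : 'I_n) : (i < j)%N -> i != j.
  by move=> ij; rewrite -val_eqE /= ltn_eqF.
pose area (i j k : 'I_n) := (pt j 0 0 - pt i 0 0) * (pt k 0 1 - pt i 0 1)
    - (pt j 0 1 - pt i 0 1) * (pt k 0 0 - pt i 0 0).
have Habc : area a b c < 0 by apply: cw.
have Habd : area a b d < 0 by apply: cw.
have Hacd : area a c d < 0 by apply: cw.
have Hbcd : area b c d < 0 by apply: cw.
pose W := area b c d + area a b d.
have WE : W = area a c d + area a b c by rewrite /W /area; ring.
have W0 : W < 0 by rewrite /W; lra.
have Wn : W != 0 by rewrite lt_eqF.
apply/eqP/set0P.
exists ((area b c d / W) *: pt a + (area a b d / W) *: pt c); split.
  apply: segment_hull; rewrite ?neq //.
  - by rewrite mulr_le0 ?invr_le0 ?ltW.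
  - by rewrite mulr_le0 ?invr_le0 ?ltW.
  - by rewrite -mulrDl divff.
have -> : (area b c d / W) *: pt a + (area a b d / W) *: pt c =
    (area a c d / W) *: pt b + (area a b c / W) *: pt d.
  apply/rowP => i; rewrite !mxE.
  rewrite -![_ / W * _]mulrAC -!mulrDl; congr (_ / W).
  have [->|->] : i = 0 \/ i = 1.
    by case: i => [[|[|//]] hi]; [left|right]; apply: val_inj.
  - by rewrite /area; ring.
  - by rewrite /area; ring.
apply: segment_hull; rewrite ?neq //.
- by rewrite mulr_le0 ?invr_le0 ?ltW.
- by rewrite mulr_le0 ?invr_le0 ?ltW.
- by rewrite -mulrDl -WE divff.
Qed.

(** If two elements of [C] had different pivots in [B], a vertex of [B] would separate
    them; without a crossing, all of [B] then lies between them, and their pivots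
    agree around the circle. *)
Lemma noncrossing_familyP (R : realType) n (pt : 'I_n -> 'rV[R]_2)
    (sigma : {set {set 'I_n}}) :
  clockwise pt -> noncrossing pt sigma ->
  noncrossing_family [seq B <- index_enum _ | B \in sigma].
Proof.
move=> cw [/and3P[_ triv n0] nc].
have mem B : (B \in [seq B <- index_enum _ | B \in sigma]) = (B \in sigma).
  by rewrite mem_filter mem_index_enum andbT.
split; first by rewrite filter_uniq // index_enum_uniq.
  by move=> B; rewrite mem => Bs; apply: contraNneq n0 => <-.
move=> B C; rewrite !mem => Bs Cs BC.
have dis : [disjoint B & C] by exact: (finset.trivIsetP triv _ _ Bs Cs BC).
split=> // c c'.
have noX (a b x d : 'I_n) : (a < b)%N -> (b < x)%N -> (x < d)%N ->
    a \in B -> b \in C -> x \in B -> d \in C -> False.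
  move=> ab bx xd aB bC xB dC; apply: (diagonals_cross cw ab bx xd aB bC xB dC).
  exact: nc.
have noX' (a b x d : 'I_n) : (a < b)%N -> (b < x)%N -> (x < d)%N ->
    a \in C -> b \in B -> x \in C -> d \in B -> False.
  move=> ab bx xd aB bC xB dC; apply: (diagonals_cross cw ab bx xd aB bC xB dC).
  by apply: nc; rewrite // eq_sym.
wlog cc : c c' / (c < c')%N => [H cC c'C|cC c'C].
  have [lt|lt|/val_inj -> //] := ltngtP c c'; first exact: H.
  by rewrite (H c' c).
have B0 : B != finset.set0 by apply: contraNneq n0 => <-.
have lastE : last c (enum B) = last c' (enum B) by apply: last_enum_const.
have neC (b x : 'I_n) : b \in B -> x \in C -> (b < x)%N || (x < b)%N.
  move=> bB xC; rewrite -neq_ltn val_eqE.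
  by apply: contraTneq bB => ->; rewrite (disjointFl dis).
have [[b bB /andP[cb bc']]|none] :
    (exists2 b, b \in B & (c < b)%N && (b < c')%N) \/
    (forall b, b \in B -> (b < c')%N = (b < c)%N).
  have [/exists_inP h|/exists_inPn h] :=
    boolP [exists b in B, (c < b)%N && (b < c')%N].
    by left.
  by right=> b bB; have := h b bB; have := neC b c bB cC; lia.
- rewrite pivot_before ?[RHS]pivot_after //.
    apply/allP => x; rewrite mem_enum => xB; case/orP: (neC x c' xB c'C) => // lt.
    by case: (noX' c b c' x).
  apply/allP => x; rewrite mem_enum => xB; case/orP: (neC x c xB cC) => [lt|/ltnW //].
  by case: (noX x c b c').
- rewrite /pivot lastE; congr last; apply: eq_in_filter => b; rewrite mem_enum.
  by move=> /none.
Qed.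

Lemma delta_connected n (T : Type) (e : 'I_n -> T) :
  (forall m, e (delta n m) = e m) -> forall k l, e k = e l.
Proof.
move=> h; suff e0 m (k l : 'I_n) : (k <= m)%N -> l = 0%N :> nat -> e k = e l.
  move=> k l; have n0 : (0 < n)%N by have := ltn_ord k; lia.
  by rewrite !(e0 n _ (Ordinal n0)) // ltnW.
elim: m k l => [|m IH] k l km l0.
  by congr e; apply: val_inj; rewrite /= l0; move: km; lia.
have [k0|k0] := posnP k; first by congr e; apply: val_inj; rewrite /= l0 k0.
have ltk : (k.-1 < n)%N by have := ltn_ord k; lia.
have <- : delta n (Ordinal ltk) = k.
  by apply: val_inj; rewrite /= delta_val /= prednK // ltn_ord.
by rewrite h; apply: IH => //=; lia.
Qed.

(** * Relabelling and rescaling *)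

Lemma porbits_invariant n (V : zmodType) (g : {perm 'I_n}) (e : 'I_n -> V) B k l :
  (forall m, e (g m) = e m) -> B \in porbits g -> k \in B -> l \in B -> e k = e l.
Proof.
move=> h /imsetP[x _ ->] /porbitP[i ->] /porbitP[j ->].
have pw a : e ((g ^+ a)%g x) = e x.
  by elim: a => [|a IH]; rewrite ?perm1 // expgSr permM h.
by rewrite !pw.
Qed.

Lemma porbits_step n (g : {perm 'I_n}) m :
  exists2 B, B \in porbits g & (m \in B) && (g m \in B).
Proof.
exists (porbit g m); first exact: imset_f.
by rewrite porbit_id; have := mem_porbit g 1 m; rewrite expg1.
Qed.

Lemma rescaled_of_steps (R : realType) n (q : R) (sigma : {set {set 'I_n}})
    (g : {perm 'I_n}) (p p' : 'I_n -> 'rV[R]_n.-1) :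
  (forall B k l, B \in sigma -> k \in B -> l \in B ->
    p' l - p' k = q *: (p l - p k)) ->
  (forall m, p' (g m) - p (g m) = p' m - p m) ->
  rescaled q sigma (porbits g) p p'.
Proof.
move=> hs hg; split=> [B k l|B k l Bg kB lB]; first exact: hs.
have /rowP h := porbits_invariant (e := fun k => p' k - p k) hg Bg lB kB.
by apply/rowP => i; move: (h i); rewrite !mxE; lra.
Qed.

Section RelabelRescale.
Variables (R : realType) (n : nat) (t : seq {set 'I_n}).
Hypothesis nf : noncrossing_family t.
Hypothesis cov : forall k, exists2 B, B \in t & k \in B.
Implicit Types (p : 'I_n -> 'rV[R]_n.-1) (q : R).

Let f : {perm 'I_n} := (\prod_(B <- t) block_cycle B)%g.

Definition total_drift q p k := \sum_(B <- t) drift q B p k.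

Lemma mem_prod_block_cycle B k : B \in t -> (f k \in B) = (k \in B).
Proof.
move=> Bt; have [C Ct kC] := cov k; rewrite /f (prod_block_cycle_in nf Ct) //.
have [<-|CB] := eqVneq C B; first by rewrite mem_block_cycle.
have [_ _ /(_ _ _ Ct Bt CB)[dis _]] := nf.
by rewrite !(disjointFr dis) ?mem_block_cycle.
Qed.

(** The pivot of [f k] in its own block is [k], and the other blocks translate the
    whole block alike. *)
Lemma total_drift_block q p B k l : B \in t -> k \in B -> l \in B ->
  total_drift q p (f l) - total_drift q p (f k) = (1 - q) *: (p k - p l).
Proof.
move=> Bt kB lB; have [un ne nc] := nf.
have dB j : j \in B -> drift q B p (f j) = (1 - q) *: (p (last k (enum B)) - p j).
  move=> jB; rewrite /drift /f (prod_block_cycle_in nf Bt) // block_cycle_pivot //.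
  by congr (_ *: (p _ - _)); apply/last_enum_const/ne.
rewrite /total_drift !(bigD1_seq B) //= !dB //.
rewrite [X in _ + X - _](_ : _ = \sum_(C <- t | C != B) drift q C p (f k)).
  rewrite opprD addrACA subrr addr0 -scalerBr; congr (_ *: _).
  by rewrite opprB addrC subrKA.
rewrite big_seq_cond [RHS]big_seq_cond; apply: eq_bigr => C /andP[Ct CB].
by apply: (drift_const _ _ (ne _ Ct) (nc _ _ Ct Bt CB)); rewrite mem_prod_block_cycle.
Qed.

(** The labels [delta m] and [f m] have the same pivot in every block: it is [m] for
    the block of [m], and otherwise the pivot of [m], since [f m] and [m] are in one
    block. *)
Lemma total_drift_delta q p m :
  total_drift q p (delta n m) = total_drift q p (f m).
Proof.
have [un ne nc] := nf.
apply: eq_big_seq => B Bt; have B0 := ne _ Bt; rewrite /drift.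
have -> : last (delta n m) (enum B) = last (f m) (enum B).
  exact: last_enum_const.
congr (_ *: (_ - p _)); rewrite pivot_delta //; case: ifPn => mB.
  by rewrite /f (prod_block_cycle_in nf Bt) // block_cycle_pivot.
have [C Ct mC] := cov m.
have BC : B != C by apply: contraNneq mB => ->.
by have [_ gap] := nc _ _ Bt Ct BC; apply: gap => //; rewrite mem_prod_block_cycle.
Qed.

Lemma jointly_connect_porbits (sigma : {set {set 'I_n}}) (g : {perm 'I_n}) :
  sigma =i t -> delta n = (f * g)%g \/ delta n = (g * f)%g ->
  jointly_connect R sigma (porbits g).
Proof.
move=> st gE e eC; apply: delta_connected.
have ef m : e (f m) = e m.
  have [B Bt mB] := cov m; apply: (eC B) => //; last by rewrite mem_prod_block_cycle.
  by rewrite inE st Bt.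
have eg m : e (g m) = e m.
  have [B Bg /andP[mB gmB]] := porbits_step g m; apply: (eC B) => //.
  by rewrite inE Bg orbT.
by case: gE => -> m; rewrite permM ?ef ?eg ?ef.
Qed.

End RelabelRescale.

Theorem theoremB (R : realType) (n : nat) (hn : (2 <= n)%N)
    (q : R) (hq : 0 < q)
    (pt : 'I_n -> 'rV[R]_2)
    (hconvex : convex_position pt) (hclockwise : clockwise pt)
    (sigma : {set {set 'I_n}}) (hsigma : noncrossing pt sigma) :
  relabels_and_rescales q sigma.
Proof.
have q0 : q != 0 by rewrite gt_eqF.
have q1 : 1 != 0 :> R by rewrite oner_neq0.
have nf := noncrossing_familyP hclockwise hsigma.
set t := [seq B <- _ | _] in nf.
have st : sigma =i t by move=> B; rewrite mem_filter mem_index_enum andbT.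
have cov k : exists2 B, B \in t & k \in B.
  case: hsigma => /and3P[/eqP cs _ _] _.
  have /bigcupP[B Bs kB] : k \in finset.cover sigma by rewrite cs inE.
  by exists B => //; rewrite -st.
have [Q rQ Qp] := realizes_family q0 nf.
have [P rP Pp0] := realizes_family q1 nf.
pose f := nc_perm sigma.
have fE : f = (\prod_(B <- t) block_cycle B)%g by rewrite /f /nc_perm -big_filter.
have sE : s_dual sigma = (\prod_(B <- t) s_block B)%g by rewrite /s_dual -big_filter.
rewrite -fE in Qp Pp0.
rewrite -sE -/(S_mx q sigma) in rQ; rewrite -sE -/(P_mx R sigma) in rP.
(* At q = 1 the drifts vanish and only the relabelling remains. *)
have Pp p k : transform P p k = p (f^-1 k)%g.
  by rewrite Pp0 big1 ?addr0 // => B _; rewrite /drift subrr scale0r.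
have uP : P_mx R sigma \in unitmx by exact: simplicial_rep_unit.
have uP' : P \in unitmx by case: rP.
have Qblock p B k l : B \in t -> k \in B -> l \in B ->
    transform Q p (f l) - transform Q p (f k) = q *: (p l - p k).
  move=> Bt kB lB; rewrite !Qp !permK opprD addrACA.
  rewrite fE -[X in _ + X]/(total_drift t q p _ - total_drift t q p _).
  rewrite (total_drift_block nf cov _ _ Bt kB lB) -(opprB (p l)) scalerN.
  by rewrite -{1}[p l - p k]scale1r -scalerBl opprB addrC subrK.
have Qdelta p m :
    transform Q p (delta n m) - p ((f^-1)%g (delta n m)) = transform Q p (f m) - p m.
  rewrite !Qp permK addrAC subrr add0r [RHS]addrAC subrr add0r fE.
  exact: total_drift_delta.
split.
- rewrite -/f (@rescaling_mxE _ _ _ _ _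
    (invmx (P_mx R sigma) *m S_mx q sigma) (invmx P *m Q)).
  + by rewrite mulKVmx.
  + apply: (jointly_connect_porbits nf cov) => //; right.
    by rewrite -fE /rc mulgKV.
  + by apply: realizesM => //; apply: realizesV.
  move=> p.
  (* Undoing the relabelling on the left renames the labels of the image. *)
  have iE k : transform (invmx P *m Q) p k = transform Q p (f k).
    by rewrite -{2}[Q](mulKVmx uP') [in RHS]transformM Pp permK.
  apply: rescaled_of_steps => [B k l|m]; first by rewrite st !iE; apply: Qblock.
  by rewrite !iE rcE -Qdelta /rc permM.
- rewrite -/f (@rescaling_mxE _ _ _ _ _
    (S_mx q sigma *m invmx (P_mx R sigma)) (Q *m invmx P)).
  + by rewrite mulmxKV.
  + apply: (jointly_connect_porbits nf cov) => //; left.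
    by rewrite -fE /lc mulKVg.
  + by apply: realizesM => //; apply: realizesV.
  move=> p; rewrite transformM; set r := transform (invmx P) p.
  have rE k : p k = r ((f^-1)%g k).
    by rewrite -Pp -transformM mulmxV // transform1.
  apply: rescaled_of_steps => [B k l|m].
    rewrite st => Bt kB lB.
    rewrite -{1}(permKV f k) -{1}(permKV f l) (Qblock _ B) ?rE //.
      by rewrite -(mem_prod_block_cycle nf cov _ Bt) -fE permKV.
    by rewrite -(mem_prod_block_cycle nf cov _ Bt) -fE permKV.
  rewrite -(permKV f m) lcE !rE permK; exact: Qdelta.
Qed.
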